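(* There is a choice of the constant $\alpha>0$ in the inner product of $H_2=\mathcal{D}(\mathcal{A})\times\mathcal{H}\times\mathcal{H}$ such that the linear operator $A:\mathcal{D}(A)\to H_2$ given by $$A=\begin{pmatrix}0&I&0\\-c^2\mathcal{A}&-b\mathcal{A}&I\\0&0&-a\mathcal{A}\end{pmatrix},\qquad \mathcal{D}(A)=\mathcal{D}(\mathcal{A})\times\mathcal{D}(\mathcal{A})\times\mathcal{D}(\mathcal{A}),$$ generates an analytic semigroup $S(t)$ on $H_2$.
   Context: $\mathcal{H}$ is a (separable) Hilbert space with inner product $\langle\cdot,\cdot\rangle_{\mathcal{H}}$ and norm $\|\cdot\|_{\mathcal{H}}$ (in applications $\mathcal{H}=L^2(\Omega)$, $\Omega\subset\mathbb{R}^d$, $d\in\{1,2,3\}$, open and bounded with smooth boundary). $\mathcal{A}:\mathcal{D}(\mathcal{A})\to\mathcal{H}$ is a self-adjoint, strictly positive, closed operator with domain $\mathcal{D}(\mathcal{A})$ dense in $\mathcal{H}$ (in applications $\mathcal{A}=-\Delta$ with domain $H^2(\Omega)\cap H_0^1(\Omega)$), and $\underline{\mu}:=\min\sigma(\mathcal{A})>0$. It is assumed that $\|v\|_{\mathcal{H}}\le C_\nu\|\mathcal{A}^\nu v\|_{\mathcal{H}}$ for $v\in\mathcal{D}(\mathcal{A}^\nu)$, $\nu=\tfrac12,1,\tfrac32$. The constants $a,b,c$ are positive. The space $H_2$ carries the inner product $\langle x,y\rangle_{H_2}=\frac{\alpha^2b^2}{4}\langle\mathcal{A}x_1,\mathcal{A}y_1\rangle_{\mathcal{H}}+\langle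 x_2,y_2\rangle_{\mathcal{H}}+\langle x_3,y_3\rangle_{\mathcal{H}}$, with a constant $\alpha>0$. *)

(* Defs.v *)
From HB Require Import structures.
From mathcomp Require Import all_boot all_order all_algebra.
From mathcomp Require Import sesquilinear ring.

Set Implicit Arguments.
Unset Strict Implicit.
Unset Printing Implicit Defensive.

Import Order.TTheory GRing.Theory Num.Theory Num.Def.

Local Open Scope ring_scope.

Lemma weighted_sumP (K : comPzRingType) (k l p q r p' q' r' : K) :
  k * (l * p + p') + (l * q + q') + (l * r + r') =
  l * (k * p + q + r) + (k * p' + q' + r').
Proof. ring. Qed.

(** The library proves Cauchy-Schwarz for finite-dimensional spaces only. *)
Section DotNorm.
Context (C : numClosedFieldType) (V : lmodType C).
Variable f : {dot V for (@conjC C)}.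

Lemma dot_cauchy_schwarz u v : `|f u v| ^+ 2 <= f u u * f v v.
Proof.
have [->|v0] := eqVneq v 0.
  by rewrite !raddf0 normr0 expr0n mulr0.
have fv : 0 < f v v by rewrite dnorm_gt0.
have fvr : (f v v)^* = f v v by apply/CrealP/ger0_real/ltW.
pose w := f v v *: u - f u v *: v.
have : 0 <= f w w by exact: dnorm_ge0.
have -> : f w w = f v v * (f u u * f v v - `|f u v| ^+ 2).
  rewrite /w !linearBl !linearBr /= !linearZl_LR /= !linearZr_LR /= fvr.
  have -> : f v u = (f u v)^* by rewrite hermC expr0 mul1r.
  rewrite normCK; ring.
by rewrite pmulr_rge0// subr_ge0.
Qed.

Definition dot_norm u : C := sqrtC (f u u).

Lemma dot_normD u v : dot_norm (u + v) <= dot_norm u + dot_norm v.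
Proof.
have n0 x : 0 <= dot_norm x by rewrite sqrtC_ge0 dnorm_ge0.
rewrite -(@ler_pXn2r _ 2)// ?nnegrE ?addr_ge0//.
rewrite /dot_norm sqrrD !sqrtCK dnormD [leRHS]addrAC lerD2l.
rewrite -sqrtCM ?nnegrE ?dnorm_ge0//.
apply: (@le_trans _ _ (`|f u v| *+ 2)); last first.
  rewrite lerMn2r /= -(@ler_pXn2r _ 2)// ?nnegrE ?sqrtC_ge0 ?mulr_ge0 ?dnorm_ge0//.
  by rewrite sqrtCK dot_cauchy_schwarz.
have r0 : f u v + (f u v)^* \is Num.real.
  by apply/CrealP; rewrite rmorphD /= conjCK addrC.
apply: le_trans (real_ler_norm r0) _.
by rewrite mulr2n (le_trans (ler_normD _ _))// norm_conjC.
Qed.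

Lemma dot_normZ (l : C) u : dot_norm (l *: u) = `|l| * dot_norm u.
Proof.
by rewrite /dot_norm dnormZ sqrtCM ?nnegrE ?exprn_ge0 ?dnorm_ge0// sqrCK.
Qed.

Lemma dot_norm0_eq0 u : dot_norm u = 0 -> u = 0.
Proof. by move=> /eqP; rewrite sqrtC_eq0 dnorm_eq0 => /eqP. Qed.

End DotNorm.

From mathcomp Require Import complex.
From mathcomp Require Import all_classical all_reals all_analysis.

Import numFieldNormedType.Exports.

Local Open Scope classical_set_scope.
Local Open Scope complex_scope.

(** The field [R[i]] with its canonical structures, among which its topology. *)
Definition cplx (R : realType) : numClosedFieldType := R[i].

Definition toC (R : realType) (x : R) : cplx R := x%:C.

HB.mixin Record NormedModule_isPreHilbert (R : realType) V
    of NormedModule (cplx R) V := {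
  inner : {dot V for (@conjC (cplx R))} ;
  sqr_norm_inner : forall x : V, `|x| ^+ 2 = inner x x
}.

#[short(type="preHilbertType")]
HB.structure Definition PreHilbert (R : realType) :=
  {V of NormedModule (cplx R) V & NormedModule_isPreHilbert R V}.

#[short(type="hilbertType")]
HB.structure Definition Hilbert (R : realType) :=
  {V of PreHilbert R V & CompleteNormedModule (cplx R) V}.

(** Norm and topology induced by an inner product. *)
HB.factory Record Lmodule_isPreHilbert (R : realType) V
    of GRing.Lmodule (cplx R) V := {
  dot_form : {dot V for (@conjC (cplx R))}
}.

HB.builders Context R V of Lmodule_isPreHilbert R V.

HB.instance Definition _ := @Lmodule_isNormed.Build (cplx R) V (dot_norm dot_form)
  (dot_normD dot_form) (dot_normZ dot_form) (@dot_norm0_eq0 _ _ dot_form).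

Lemma sqr_norm_dot (x : V) : `|x| ^+ 2 = dot_form x x.
Proof. by rewrite sqrtCK. Qed.

HB.instance Definition _ :=
  NormedModule_isPreHilbert.Build R V sqr_norm_dot.

HB.end.

(** * Unbounded operators *)

Section Submodule.
Context (K : pzRingType) (V : lmodType K) (D : submodClosed V).

Record submod := Submod { submod_val : V; submodP : submod_val \in D }.

HB.instance Definition _ := [isSub for submod_val].
HB.instance Definition _ := [Choice of submod by <:].
HB.instance Definition _ := [SubChoice_isSubLmodule of submod by <:].

End Submodule.

Record operator (K : pzRingType) (V W : lmodType K) := Operator {
  dom : submodClosed V ;
  op_fun :> {linear submod dom -> W}
}.

Definition graph (K : pzRingType) (V W : lmodType K) (T : operator V W)
    (x : V) (y : W) : Prop :=
  exists2 u : submod (dom T), \val u = x & T u = y.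

Definition bounded_op (K : numFieldType) (V W : normedModType K)
    (f : V -> W) : Prop :=
  exists M : K, forall x, `|f x| <= M * `|x|.

Definition closed_operator (K : numFieldType) (V W : normedModType K)
    (T : operator V W) : Prop :=
  closed [set p : V * W | graph T p.1 p.2].

Definition densely_defined (K : numFieldType) (V : normedModType K)
    (W : lmodType K) (T : operator V W) : Prop :=
  dense [set x : V | x \in dom T].

Section Spectrum.
Context (K : numFieldType) (V : normedModType K) (T : operator V V).

Definition resolvent_set : set K := [set l |
  exists S : {linear V -> submod (dom T)},
    [/\ cancel S (fun u => l *: \val u - T u),
        cancel (fun u => l *: \val u - T u) S
      & bounded_op (fun y => \val (S y))]].

Definition spectrum : set K := ~` resolvent_set.

End Spectrum.

Section HilbertOperators.
Context (R : realType) (H : hilbertType R).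
Implicit Types T B : operator H H.

(** [T] is densely defined and its graph is the graph of its adjoint. *)
Definition self_adjoint T : Prop :=
  densely_defined T /\
  forall y z, graph T y z <->
    (forall u : submod (dom T), inner (T u) y = inner (\val u) z).

Definition strictly_positive T : Prop :=
  forall u : submod (dom T), u != 0 -> 0 < inner (T u) (\val u).

(** The order of [cplx R] relates only numbers with the same imaginary part, so
    the second condition also says that the spectrum is real. *)
Definition is_min_spectrum T (mu : R) : Prop :=
  spectrum T (toC mu) /\ forall l, spectrum T l -> toC mu <= l.

(** [B] is the nonnegative self-adjoint square root of [T]. *)
Definition is_sqrt_op T B : Prop :=
  [/\ self_adjoint B,
      forall u : submod (dom B), 0 <= inner (B u) (\val u)
    & forall x y, graph T x y <-> exists2 z, graph B x z & graph B z y].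

(** |v| <= C_nu |T^nu v| on the domain of T^nu for nu = 1/2, 1, 3/2, where
    T^(3/2) = T^(1/2) o T. *)
Definition power_bounds T : Prop :=
  [/\ exists C : cplx R, forall B, is_sqrt_op T B ->
        forall v w, graph B v w -> `|v| <= C * `|w|,
      exists C : cplx R, forall v w, graph T v w -> `|v| <= C * `|w|
    & exists C : cplx R, forall B, is_sqrt_op T B ->
        forall v z w, graph T v z -> graph B z w -> `|v| <= C * `|w|].

End HilbertOperators.

Record positive_operator (R : realType) (H : hilbertType R) :=
  PositiveOperator {
    pos_op :> operator H H ;
    pos_opP : strictly_positive pos_op
  }.

Definition separable (T : topologicalType) : Prop :=
  exists2 S : set T, countable S & dense S.

(** * Analytic semigroups *)

Section AnalyticSemigroup.
Context (R : realType) (X : normedModType (cplx R)).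

(** The open sector |arg z| < theta. *)
Definition sector (theta : R) : set (cplx R) := [set z |
  exists r phi : R, [/\ 0 < r, `|phi| < theta
    & z = (r * cos phi) +i* (r * sin phi)]].

(** Complex differentiability of an operator-valued map in operator norm. *)
Definition op_derivable (S : cplx R -> {linear X -> X}) (z : cplx R) : Prop :=
  exists2 L : {linear X -> X}, bounded_op L &
    forall eps : cplx R, 0 < eps -> \forall h \near (0 : cplx R)^',
      forall x, `|h^-1 *: (S (z + h) x - S z x) - L x| <= eps * `|x|.

(** The values of [S] off [sector theta] and 0 are irrelevant. *)
Record analytic_semigroup (theta : R) (S : cplx R -> {linear X -> X}) : Prop := {
  asg_bounded : forall z, sector theta z -> bounded_op (S z) ;
  asg_0 : forall x, S 0 x = x ;
  asg_add : forall z w, sector theta z -> sector theta w ->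
    forall x, S (z + w) x = S z (S w x) ;
  asg_analytic : forall z, sector theta z -> op_derivable S z ;
  asg_cvg0 : forall x,
    S z x @[z --> within (sector theta) (nbhs (0 : cplx R))] --> x
}.

(** [T] is the infinitesimal generator of the semigroup [S t], t >= 0. *)
Definition is_generator (T : operator X X) (S : cplx R -> {linear X -> X}) :
    Prop :=
  forall x y, graph T x y <->
    (toC t)^-1 *: (S (toC t) x - x) @[t --> (0 : R)^'+] --> y.

Definition generates_analytic_semigroup (T : operator X X) : Prop :=
  exists theta : R, exists S : cplx R -> {linear X -> X},
    [/\ 0 < theta <= pi / 2, analytic_semigroup theta S & is_generator T S].

End AnalyticSemigroup.

(** * The space [H2] and the block operator *)

Section H2.
Context (R : realType) (H : hilbertType R).

Definition H2 (alpha b : {posnum R}) (A : positive_operator H) : Type :=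
  (submod (dom A) * H * H)%type.

Context (alpha b : {posnum R}) (A : positive_operator H).

HB.instance Definition _ :=
  GRing.Lmodule.copy (H2 alpha b A) (submod (dom A) * H * H)%type.

Definition H2_inner (x y : H2 alpha b A) : cplx R :=
  toC (alpha%:num ^+ 2 * b%:num ^+ 2 / 4) * inner (A x.1.1) (A y.1.1)
  + inner x.1.2 y.1.2 + inner x.2 y.2.

Let weight_gt0 : 0 < toC (alpha%:num ^+ 2 * b%:num ^+ 2 / 4) :> cplx R.
Proof. by rewrite ltcR. Qed.

Fact H2_inner_bilinear :
  bilinear_for (@GRing.mul (cplx R)) (@conjC (cplx R) \; *%R) H2_inner.
Proof.
split=> [y|x] l u v; rewrite /H2_inner /=.
  rewrite linearP !linearPl /=.
  exact: (@weighted_sumP (cplx R) (toC (alpha%:num ^+ 2 * b%:num ^+ 2 / 4)) l).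
rewrite (linearP (op_fun A)) ![inner _ (_ + _)]linearPr /=.
exact: (@weighted_sumP (cplx R) (toC (alpha%:num ^+ 2 * b%:num ^+ 2 / 4)) (conjC l)).
Qed.

HB.instance Definition _ := bilinear_isBilinear.Build (cplx R) (H2 alpha b A)
  (H2 alpha b A) (cplx R) _ _ H2_inner H2_inner_bilinear.

Fact H2_inner_hermitian (x y : H2 alpha b A) :
  H2_inner x y = (-1) ^+ false * conjC (H2_inner y x).
Proof.
have kr : conjC (toC (alpha%:num ^+ 2 * b%:num ^+ 2 / 4))
    = toC (alpha%:num ^+ 2 * b%:num ^+ 2 / 4) :> cplx R.
  exact/CrealP/ger0_real/ltW.
rewrite expr0 mul1r /H2_inner 2!(rmorphD conjC) /= (rmorphM conjC) /= kr.
rewrite (hermC _ (A x.1.1)) (hermC _ x.1.2) (hermC _ x.2).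
by rewrite !expr0 !mul1r.
Qed.

HB.instance Definition _ := isHermitianSesquilinear.Build (cplx R) (H2 alpha b A)
  false (@conjC (cplx R)) H2_inner H2_inner_hermitian.

Fact H2_inner_gt0 (x : H2 alpha b A) : x != 0 -> 0 < H2_inner x x.
Proof.
move: x => [[x1 x2] x3] x0.
have A0 : A x1 = 0 -> x1 = 0.
  move=> Ax1; apply/eqP/negPn/negP => /(pos_opP (p := A)).
  by rewrite Ax1 linear0l ltxx.
have k0 := dnorm_ge0 inner (A x1); have k2 := dnorm_ge0 inner x2.
have k3 := dnorm_ge0 inner x3.
rewrite lt_neqAle /H2_inner /= !addr_ge0 ?(mulr_ge0 (ltW weight_gt0))// andbT.
apply: contra_neq x0 => /esym/eqP.
rewrite !paddr_eq0 ?addr_ge0 ?(mulr_ge0 (ltW weight_gt0))//.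
rewrite mulf_eq0 (gt_eqF weight_gt0) !dnorm_eq0 /=.
by move=> /andP[/andP[/eqP/A0 -> /eqP ->] /eqP ->].
Qed.

HB.instance Definition _ := isDotProduct.Build (cplx R) (H2 alpha b A)
  H2_inner H2_inner_gt0.

HB.instance Definition _ := Lmodule_isPreHilbert.Build R (H2 alpha b A) H2_inner.

Lemma H2_innerE (x y : H2 alpha b A) : inner x y = H2_inner x y.
Proof. by []. Qed.

End H2.

Section BlockOperator.
Context (R : realType) (H : hilbertType R).
Context (alpha a b c : {posnum R}) (A : positive_operator H).
Implicit Types x : H2 alpha b A.

(** D(A) x D(A) x D(A); the first component is in D(A) by definition of [H2]. *)
Definition block_pred : {pred H2 alpha b A} :=
  [pred x | (x.1.2 \in dom A) && (x.2 \in dom A)].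

Fact block_pred_submod : submod_closed block_pred.
Proof.
split=> [|l u v]; first by rewrite inE !rpred0.
by rewrite !inE => /andP[u2 u3] /andP[v2 v3]; rewrite !rpredD ?rpredZ.
Qed.

HB.instance Definition _ :=
  GRing.isSubmodClosed.Build (cplx R) (H2 alpha b A) block_pred block_pred_submod.

Definition block_dom : submodClosed (H2 alpha b A) := block_pred.

Fact block_dom2 (u : submod block_dom) : (\val u).1.2 \in dom A.
Proof. by case/andP: (valP u). Qed.

Fact block_dom3 (u : submod block_dom) : (\val u).2 \in dom A.
Proof. by case/andP: (valP u). Qed.

Definition block_fun (u : submod block_dom) : H2 alpha b A :=
  let x1 := (\val u).1.1 in
  let x2 := Submod (block_dom2 u) in
  let x3 := Submod (block_dom3 u) in
  (x2,
   - toC (c%:num ^+ 2) *: A x1 - toC b%:num *: A x2 + \val x3,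
   - toC a%:num *: A x3).

Fact block_fun_linear : linear block_fun.
Proof.
move=> l u v.
have e2 : Submod (block_dom2 (l *: u + v)) =
    l *: Submod (block_dom2 u) + Submod (block_dom2 v) by exact: val_inj.
have e3 : Submod (block_dom3 (l *: u + v)) =
    l *: Submod (block_dom3 u) + Submod (block_dom3 v) by exact: val_inj.
have key (k : cplx R) (p q : H) : k *: (l *: p + q) = l *: (k *: p) + k *: q.
  by rewrite scalerDr !scalerA mulrC.
have key2 (p q r p' q' r' : H) :
    l *: p + p' - (l *: q + q') + (l *: r + r') =
    l *: (p - q + r) + (p' - q' + r').
  rewrite !scalerDr scalerN opprD (addrACA (l *: p)).
  by rewrite (addrACA (l *: p - l *: q)).
by rewrite /block_fun e2 e3 !(linearP (op_fun A)) !key key2.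
Qed.

HB.instance Definition _ := GRing.isLinear.Build (cplx R) (submod block_dom)
  (H2 alpha b A) _ block_fun block_fun_linear.

Definition block_operator : operator (H2 alpha b A) (H2 alpha b A) :=
  @Operator _ _ _ block_dom block_fun.

End BlockOperator.

(* Main.v *)
Require Import Defs.
From HB Require Import structures.
From mathcomp Require Import all_boot all_order all_algebra.
From mathcomp Require Import ring lra complex.
From mathcomp Require Import all_classical all_reals all_analysis.

(** Take alpha = 2 / b, so that the norm of H2 is that of (A x1, x2, x3).  In the
    coordinates (p, x2, x3) with p = A x1 + x2 / b, the unbounded parts of the
    first equation cancel and the operator L becomes - diag (0, b A, a A) plus a
    bounded operator.  As A is positive, 1 - z L is invertible for Re z >= 0 and
    small |z|, and in the norm |p| + |x2| + |x3| its inverse J z has norm at most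
    exp (g |z|).

    The semigroup is the limit S z of the implicit Euler schemes
    J (z / 2^k) ^ (2^k), on the whole half plane Re z >= 0.  On D(L^2) consecutive
    schemes differ by O(2^-k), because
    J z J w - J (z + w) = - z w J z J w J (z + w) L^2;
    the same identity gives S (z + w) = S z S w.

    Analyticity needs L S(t) to be bounded for t > 0.  This is an energy estimate
    for the Euler scheme: if w' = - k A w + f with f and w bounded, the integral of
    t |A w|^2 over [0, T] is bounded, and |L S(t) x| is nonincreasing in t up to a
    constant factor.  Then S z = S (z - 2 t) S t S t maps into D(L^2) and is
    differentiable in operator norm. *)

Set Implicit Arguments.
Unset Strict Implicit.
Unset Printing Implicit Defensive.

Import Order.TTheory GRing.Theory Num.Theory.
Import numFieldNormedType.Exports.
Import ComplexField.

Local Open Scope classical_set_scope.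
Local Open Scope ring_scope.
Local Notation Re := complex.Re.

(** * Real-valued modulus and real part of complex numbers *)

Section Modulus.
Context (R : realType).
Implicit Types z w : cplx R.

(** The norm of [cplx R] takes its values in [cplx R]; this copy of it in [R] makes real arithmetic
    and its decision procedures available. *)
Definition modc z : R := Normc.normc z.

Arguments modc : simpl never.

Lemma norm_modc z : `|z| = toC (modc z). Proof. by []. Qed.

Lemma modc_ge0 z : 0 <= modc z.
Proof. by case: z => x y; rewrite /modc /= sqrtr_ge0. Qed.

Lemma modcM z w : modc (z * w) = modc z * modc w.
Proof. exact: Normc.normcM. Qed.

Lemma modcD z w : modc (z + w) <= modc z + modc w.
Proof. exact: le_normcD. Qed.

Lemma modcN z : modc (- z) = modc z.
Proof. exact: normcN. Qed.

Lemma modcV z : modc z^-1 = (modc z)^-1.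
Proof. exact: Normc.normcV. Qed.

Lemma modc0 : modc 0 = 0. Proof. exact: Normc.normc0. Qed.

Lemma modc1 : modc 1 = 1. Proof. exact: Normc.normc1. Qed.

Lemma modc_toC (x : R) : 0 <= x -> modc (toC x) = x.
Proof. by move=> x0; rewrite /modc /= expr0n addr0 sqrtr_sqr ger0_norm. Qed.

Lemma modc_nat n : modc n%:R = n%:R.
Proof.
have -> : n%:R = toC n%:R :> cplx R by rewrite /toC rmorph_nat.
by rewrite modc_toC.
Qed.

Lemma ler_Re_modc z : Re z <= modc z.
Proof.
case: z => x y; rewrite /modc /=; apply: le_trans (ler_norm x) _.
by rewrite -sqrtr_sqr ler_wsqrtr// lerDl sqr_ge0.
Qed.

Lemma Re_toCM (x : R) z : Re (toC x * z) = x * Re z.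
Proof. by case: z => u v /=; rewrite mul0r subr0. Qed.

End Modulus.

(** * Real-valued norms on complex vector spaces and sequential limits *)

Section RealNorm.
Context (R : realType) (X : lmodType (cplx R)) (N : X -> R).
Implicit Types (x y : X) (u v : nat -> X) (e M : R).

(** An arbitrary function in place of a canonical norm: the estimates are later run in the norm
    [bnorm], which is only equivalent to the Hilbert norm of [H2]. *)
Record real_norm : Prop := {
  rnormD : forall x y, N (x + y) <= N x + N y ;
  rnormZ : forall k x, N (k *: x) = modc k * N x ;
  rnorm0_eq0 : forall x, N x = 0 -> x = 0
}.

Definition ncvg u x := forall e, 0 < e -> \forall n \near \oo, N (u n - x) <= e.

Definition ncomplete := forall u,
  (forall e, 0 < e -> \forall n \near \oo, forall m, (n <= m)%N -> N (u m - u n) <= e) ->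
  exists x, ncvg u x.

Hypothesis NN : real_norm.

Lemma rnorm0 : N 0 = 0.
Proof. by rewrite -(scale0r 0) rnormZ// modc0 mul0r. Qed.

Lemma rnormN x : N (- x) = N x.
Proof. by rewrite -scaleN1r rnormZ// modcN modc1 mul1r. Qed.

Lemma rnorm_ge0 x : 0 <= N x.
Proof.
have := rnormD NN x (- x); rewrite subrr rnorm0 rnormN => h; lra.
Qed.

Lemma rnormB x y : N (x - y) <= N x + N y.
Proof. by rewrite -(rnormN y) rnormD. Qed.

Lemma rdistC x y : N (x - y) = N (y - x).
Proof. by rewrite -rnormN opprB. Qed.

Lemma rdist_tri y x z : N (x - z) <= N (x - y) + N (y - z).
Proof. by rewrite -[x - z](subrKA y) rnormD. Qed.

Lemma ncvg_le u x y M :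
  ncvg u x -> (\forall n \near \oo, N (u n - y) <= M) -> N (x - y) <= M.
Proof.
move=> ux uM; apply/ler_addgt0Pr => e e0.
have [n [h1 h2]] : exists n, N (u n - x) <= e /\ N (u n - y) <= M.
  near \oo => n; exists n; split; near: n => //; exact: ux.
apply: le_trans (rdist_tri (u n) _ _) _.
by rewrite (rdistC x) addrC lerD.
Unshelve. all: by end_near. Qed.

Lemma ncvg_norm u x M :
  ncvg u x -> (\forall n \near \oo, N (u n) <= M) -> N x <= M.
Proof.
move=> ux uM; rewrite -[x]subr0; apply: (ncvg_le ux).
by apply: filterS uM => n; rewrite subr0.
Qed.

Lemma ncvg_unique u x y : ncvg u x -> ncvg u y -> x = y.
Proof.
move=> ux uy; apply/eqP; rewrite -subr_eq0; apply/eqP/(rnorm0_eq0 NN)/le_anti.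
rewrite rnorm_ge0 andbT; apply/ler_addgt0Pr => e e0; rewrite add0r.
exact/(ncvg_le ux)/uy.
Qed.

Lemma ncvg_near u v x : (\forall n \near \oo, u n = v n) -> ncvg u x -> ncvg v x.
Proof. by move=> uv ux e e0; near do [rewrite -(near uv)//]; exact: ux.
Unshelve. all: by end_near. Qed.

Lemma ncvg_cst x : ncvg (fun=> x) x.
Proof. by move=> e e0; near=> n; rewrite subrr rnorm0 ltW.
Unshelve. all: by end_near. Qed.

Lemma ncvgD u v x y : ncvg u x -> ncvg v y -> ncvg (fun n => u n + v n) (x + y).
Proof.
move=> ux vy e e0; have e2 : 0 < e / 2 by rewrite divr_gt0.
near=> n; rewrite opprD addrACA (le_trans (rnormD NN _ _))//.
by rewrite [leRHS](splitr e) lerD//; near: n; [exact: ux|exact: vy].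
Unshelve. all: by end_near. Qed.

Lemma ncvgM k u x (f : X -> X) : (forall y, N (f y) <= k * N y) ->
  {morph f : a b / a - b} -> ncvg u x -> ncvg (fun n => f (u n)) (f x).
Proof.
move=> fk fB ux e e0.
have ek : 0 < e / (`|k| + 1) by rewrite divr_gt0.
near=> n; rewrite -fB (le_trans (fk _))//.
apply: (@le_trans _ _ ((`|k| + 1) * N (u n - x))).
  rewrite ler_wpM2r ?rnorm_ge0// (le_trans (ler_norm k))// lerDl//.
by rewrite -ler_pdivlMl// mulrC; near: n; exact: ux.
Unshelve. all: by end_near. Qed.

Lemma ncvgZ k u x : ncvg u x -> ncvg (fun n => k *: u n) (k *: x).
Proof.
apply: (@ncvgM (modc k) _ _ (fun y => k *: y)) => [y|a b]; last exact: scalerBr.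
by rewrite rnormZ.
Qed.

Lemma ncvgB u v x y : ncvg u x -> ncvg v y -> ncvg (fun n => u n - v n) (x - y).
Proof.
move=> ux vy; have := ncvgD ux (ncvgZ (-1) vy); rewrite scaleN1r.
by apply: ncvg_near; near=> n; rewrite scaleN1r.
Unshelve. all: by end_near. Qed.

(* An n-step version of P^n - Q^n = sum P^i (P - Q) Q^(n-1-i). *)
Lemma iter_dist (P Q : X -> X) (c : R) n x : 1 <= c ->
  {morph P : a b / a - b} -> {morph Q : a b / a - b} ->
  (forall y, P (Q y) = Q (P y)) ->
  (forall y, N (P y) <= c * N y) -> (forall y, N (Q y) <= c * N y) ->
  N (iter n P x - iter n Q x) <= n%:R * c ^+ n * N (P x - Q x).
Proof.
move=> c1 PB QB PQ Pc Qc; have c0 : 0 <= c by lra.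
have iB m : {morph iter m P : a b / a - b}.
  by elim: m => //= m IH a b; rewrite -PB; congr P; apply: IH.
have iQ m y : iter m P (Q y) = Q (iter m P y).
  by elim: m => //= m ->; rewrite PQ.
have ic m y : N (iter m P y) <= c ^+ m * N y.
  elim: m => /= [|m IH]; first by rewrite mul1r.
  by rewrite exprS -mulrA (le_trans (Pc _))// ler_wpM2l.
elim: n => [|n IH]; first by rewrite subrr rnorm0 !mul0r.
(* P^(n+1) x - Q^(n+1) x = P^n (P x - Q x) + Q (P^n x - Q^n x); the induction hypothesis bounds the
   second term. *)
rewrite iterSr [iter _ Q _]iterS -(subrKA (iter n P (Q x))) -iB iQ -QB.
apply: le_trans (rnormD NN _ _) _.
rewrite -natr1 2!mulrDl mul1r addrC lerD//.
  apply: le_trans (Qc _) _.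
  by rewrite exprS mulrCA -mulrA ler_wpM2l.
apply: le_trans (ic _ _) _; rewrite ler_wpM2r ?rnorm_ge0//.
by rewrite exprS ler_peMl// exprn_ge0.
Qed.

End RealNorm.

(** * Resolvent calculus on a half disc *)

Section Semigroup.
Context (R : realType) (X : lmodType (cplx R)) (N : X -> R) (G : X -> X -> Prop)
  (J : cplx R -> X -> X) (r g : R).
Implicit Types (x y u v q : X) (z w : cplx R).

Definition half_disc z : Prop := 0 <= Re z /\ modc z <= r.

(* [J z] is (1 - z L)^-1 for the operator L with graph [G]. *)
Record half_plane_resolvent : Prop := {
  hpr_norm : real_norm N ;
  hpr_complete : ncomplete N ;
  hpr_r : 0 < r ;
  hpr_g : 0 <= g ;
  hpr_linear : forall k x y x' y', G x y -> G x' y' -> G (k *: x + x') (k *: y + y') ;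
  hpr_fun : forall x y y', G x y -> G x y' -> y = y' ;
  hpr_dense : forall x e, 0 < e -> exists u v, G u v /\ N (x - u) <= e ;
  hpr_J0 : forall x, J 0 x = x ;
  hpr_JK : forall z u v, half_disc z -> G u v -> J z (u - z *: v) = u ;
  hpr_KJ : forall z x, half_disc z -> z != 0 -> exists2 v, G (J z x) v & J z x - z *: v = x ;
  hpr_bound : forall z x, half_disc z -> N (J z x) <= expR (g * modc z) * N x
}.

Hypothesis HJ : half_plane_resolvent.
Let NN := hpr_norm HJ.
Let r0 := hpr_r HJ.
Let g0 := hpr_g HJ.

Lemma graphB u v u' v' : G u v -> G u' v' -> G (u - u') (v - v').
Proof.
move=> h h'; have := hpr_linear HJ (-1) h' h.
by rewrite !scaleN1r ![- _ + _]addrC.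
Qed.

(** The exponential form of the bound survives subdivision: the n-th power of [rho (z / n)] is
    [rho z]. *)
Let rho z := expR (g * modc z).

Let rho_ge1 z : 1 <= rho z.
Proof. by rewrite -expR0 ler_expR mulr_ge0// modc_ge0. Qed.

Let rho_gt0 z : 0 < rho z. Proof. exact: expR_gt0. Qed.

(** For z != 0 both vectors have the form u - z v with (u, v) in the graph, a linear relation, and
    [J z] sends u - z v back to u. *)
Lemma J_linear z k x y : half_disc z -> J z (k *: x + y) = k *: J z x + J z y.
Proof.
move=> hz; have [->|z0] := eqVneq z 0; first by rewrite !(hpr_J0 HJ).
have [v Gv e] := hpr_KJ HJ x hz z0; have [v' Gv' e'] := hpr_KJ HJ y hz z0.
rewrite -(hpr_JK HJ hz (hpr_linear HJ k Gv Gv')) -{1}e -{1}e'; congr J.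
by rewrite scalerBr !scalerDr !scalerA (mulrC k) opprD addrACA.
Qed.

Lemma J_B z : half_disc z -> {morph J z : x y / x - y}.
Proof.
move=> hz x y; rewrite addrC -scaleN1r J_linear//.
by rewrite scaleN1r addrC.
Qed.

Lemma J_Z z k x : half_disc z -> J z (k *: x) = k *: J z x.
Proof.
move=> hz; have := J_linear k x 0 hz; rewrite addr0 => ->.
by have := J_B hz x x; rewrite !subrr => ->; rewrite addr0.
Qed.

(** Comes from J z (u - z v) = u by linearity; it is the source of the factor z in first-order
    estimates. *)
Lemma J_sub z u v : half_disc z -> G u v -> J z u - u = z *: J z v.
Proof.
move=> hz uv; rewrite -{2}(hpr_JK HJ hz uv) -J_B//.
by rewrite subKr J_Z.
Qed.

Lemma J_graph z u v : half_disc z -> G u v -> G (J z u) (J z v).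
Proof.
move=> hz uv; have [->|z0] := eqVneq z 0; first by rewrite !(hpr_J0 HJ).
have [w Gw e] := hpr_KJ HJ u hz z0.
suff -> : J z v = w by [].
apply: (scalerI z0); rewrite -(J_sub hz uv).
by rewrite -{2}e subKr.
Qed.

Lemma J_comm z w x : half_disc z -> half_disc w -> J z (J w x) = J w (J z x).
Proof.
move=> hz hw; have [->|w0] := eqVneq w 0; first by rewrite !(hpr_J0 HJ).
have [t Gt e] := hpr_KJ HJ x hw w0.
rewrite -{2}e J_B// J_Z// (hpr_JK HJ hw)//; exact: J_graph.
Qed.

(** Since (1 - z L)(1 - w L) = 1 - (z + w) L + z w L^2, two successive steps differ from the
    combined one by a second-order term on the domain of L^2. The three resolvents left in that term
    account for the factor [2 * g], as |z + w| <= |z| + |w|. *)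
Lemma J_add z w u v q : half_disc z -> half_disc w -> half_disc (z + w) -> G u v -> G v q ->
  N (J z (J w u) - J (z + w) u) <=
  modc z * modc w * expR (2 * g * (modc z + modc w)) * N q.
Proof.
move=> hz hw hzw uv vq.
have e1 : J (z + w) (u - (z + w) *: v) = u by exact: (hpr_JK HJ hzw uv).
have e2 : J z (J w (u - (z + w) *: v + (z * w) *: q)) = u.
  rewrite -[RHS](hpr_JK HJ hz uv) -[u in RHS](hpr_JK HJ hw uv).
  rewrite -{3}(hpr_JK HJ hw vq) -J_Z// -J_B//; congr (J z (J w _)).
  rewrite scalerBr scalerA scalerDl !opprD opprK !addrA.
  by congr (_ + _); rewrite addrAC.
have -> : J z (J w u) - J (z + w) u =
    - ((z * w) *: J (z + w) (J z (J w q))).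
  rewrite -[u in J (z + w) u]e2 -{1}e1.
  rewrite [J w (J (z + w) _)]J_comm// [J z (J (z + w) _)]J_comm//.
  rewrite -J_B// -J_B// -J_B// opprD addNKr -scaleNr J_Z// J_Z// J_Z//.
  by rewrite scaleNr.
rewrite rnormN// rnormZ// modcM -!mulrA; do 2 (rewrite ler_wpM2l ?modc_ge0//).
apply: le_trans (hpr_bound HJ _ hzw) _.
have h := hpr_bound HJ q hw.
have h' := hpr_bound HJ (J w q) hz.
apply: (@le_trans _ _ (rho (z + w) * (rho z * (rho w * N q)))).
  rewrite ler_wpM2l ?(ltW (rho_gt0 _))// (le_trans h')//.
  by rewrite ler_wpM2l ?(ltW (rho_gt0 _)).
rewrite !mulrA ler_wpM2r ?rnorm_ge0// /rho -!expRD ler_expR.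
have := ler_wpM2l g0 (modcD z w); lra.
Qed.

Lemma J_dist z u v : half_disc z -> G u v -> N (J z u - u) <= modc z * rho z * N v.
Proof.
move=> hz uv; rewrite (J_sub hz uv) rnormZ// -mulrA ler_wpM2l ?modc_ge0//.
exact: (hpr_bound HJ).
Qed.

(** * Implicit Euler schemes with dyadic steps: stability and consistency *)

Definition dyadic k z : cplx R := z / (2 ^ k)%:R.

Definition euler k z x : X := iter (2 ^ k) (J (dyadic k z)) x.

Lemma modc_dyadic k z : modc (dyadic k z) = modc z / 2 ^+ k.
Proof. by rewrite modcM modcV modc_nat natrX. Qed.

Lemma Re_dyadic k z : Re (dyadic k z) = Re z / 2 ^+ k.
Proof.
rewrite /dyadic mulrC -natrX.
have -> : (2 ^ k)%:R^-1 = toC ((2 ^ k)%:R^-1) :> cplx R.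
  by rewrite /toC fmorphV rmorph_nat.
by rewrite Re_toCM mulrC.
Qed.

Lemma dyadic_half k z : half_disc (dyadic k z) -> forall j, (k <= j)%N -> half_disc (dyadic j z).
Proof.
move=> [h1 h2] j kj.
split.
  move: h1; rewrite !Re_dyadic !pmulr_lge0 ?invr_gt0//.
apply: le_trans h2; rewrite !modc_dyadic ler_wpM2l ?modc_ge0//.
by rewrite lef_pV2 ?posrE// ler_weXn2l// ler1n.
Qed.

(** The resolvent is controlled only for modulus at most [r], so a scheme is usable only once its
    step is small enough. This is why later bounds on schemes hold for large [k]. *)
Lemma near_dyadic_half z : 0 <= Re z -> \forall k \near \oo, half_disc (dyadic k z).
Proof.
move=> z0.
have m1 : 0 < modc z + 1 by rewrite ltr_wpDl ?modc_ge0.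
have e0 : 0 < r / (modc z + 1) by rewrite divr_gt0.
have := near_infty_natSinv_expn_lt (PosNum e0); apply: filterS => k /= h.
split; first by rewrite Re_dyadic divr_ge0// exprn_ge0.
rewrite modc_dyadic; move: h; rewrite ltr_pdivlMr// mul1r => /ltW.
apply: le_trans; rewrite [leRHS]mulrC ler_wpM2r ?invr_ge0 ?exprn_ge0//.
by rewrite lerDl.
Qed.

Lemma euler_B k z : half_disc (dyadic k z) -> {morph euler k z : x y / x - y}.
Proof.
rewrite /euler => hz x y; elim: (2 ^ k)%N => //= n IH.
by rewrite -J_B//; congr J; apply: IH.
Qed.

Lemma euler_linear k z a x y : half_disc (dyadic k z) ->
  euler k z (a *: x + y) = a *: euler k z x + euler k z y.
Proof.
rewrite /euler => hz; elim: (2 ^ k)%N => //= n IH.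
by rewrite -J_linear//; congr J.
Qed.

Lemma euler_graph k z u v : half_disc (dyadic k z) -> G u v -> G (euler k z u) (euler k z v).
Proof. by rewrite /euler => hz uv; elim: (2 ^ k)%N => //= n IH; apply: J_graph. Qed.

Lemma euler_J k z w x : half_disc (dyadic k z) -> half_disc w ->
  euler k z (J w x) = J w (euler k z x).
Proof.
move=> hz hw; rewrite /euler; elim: (2 ^ k)%N => //= n ->.
by rewrite J_comm.
Qed.

Let rhoX c z k : expR (c * modc (dyadic k z)) ^+ (2 ^ k) = expR (c * modc z).
Proof.
rewrite -expRM_natl modc_dyadic natrX; congr expR.
have : (2 : R) ^+ k != 0 by rewrite expf_neq0.
by move=> h; field.
Qed.

Lemma euler_bound k z x : half_disc (dyadic k z) -> N (euler k z x) <= rho z * N x.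
Proof.
move=> hz; rewrite /rho -(rhoX _ _ k) /euler.
elim: (2 ^ k)%N => [|n IH] /=; first by rewrite expr0 mul1r.
by rewrite exprS -mulrA (le_trans (hpr_bound HJ _ hz))// ler_wpM2l// ltW ?expR_gt0.
Qed.

Lemma dyadicD z w k : dyadic k (z + w) = dyadic k z + dyadic k w.
Proof. by rewrite /dyadic mulrDl. Qed.

(** One step costs O(4^-k) by [J_add], and [iter_dist] adds up 2^k of them. The rate [3 * g] is [g]
    from stability of the iterates plus [2 * g] from [J_add]. *)
Lemma euler_add k z w u v q : half_disc (dyadic k z) -> half_disc (dyadic k w) ->
  half_disc (dyadic k (z + w)) -> G u v -> G v q ->
  N (euler k z (euler k w u) - euler k (z + w) u) <=
  modc z * modc w * expR (3 * g * (modc z + modc w)) * N q / 2 ^+ k.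
Proof.
move=> hz hw hzw uv vq.
have p : 0 < 2 ^+ k :> R by rewrite exprn_gt0.
have -> : euler k z (euler k w u) =
    iter (2 ^ k) (fun x => J (dyadic k z) (J (dyadic k w) x)) u.
  have cm m y : iter m (J (dyadic k z)) (J (dyadic k w) y) =
      J (dyadic k w) (iter m (J (dyadic k z)) y).
    by elim: m => //= m ->; rewrite J_comm.
  rewrite /euler; elim: (2 ^ k)%N {uv vq} => // n IH.
  by rewrite (iterS n (J (dyadic k w))) iterS cm IH.
(* A common bound for the double step and for the combined step, as [iter_dist] requires. *)
set c := expR (g * (modc (dyadic k z) + modc (dyadic k w))).
have c1 : 1 <= c by rewrite -expR0 ler_expR mulr_ge0// addr_ge0 ?modc_ge0.
have hP y : N (J (dyadic k z) (J (dyadic k w) y)) <= c * N y.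
  rewrite /c mulrDr expRD -mulrA (le_trans (hpr_bound HJ _ hz))//.
  by rewrite ler_wpM2l ?(ltW (expR_gt0 _))// (hpr_bound HJ).
have hQ y : N (J (dyadic k (z + w)) y) <= c * N y.
  rewrite (le_trans (hpr_bound HJ _ hzw))// ler_wpM2r ?rnorm_ge0//.
  by rewrite ler_expR ler_wpM2l// dyadicD modcD.
apply: le_trans (iter_dist (c := c) NN _ _ c1 _ _ _ hP hQ) _.
- by move=> x y /=; rewrite J_B// J_B.
- exact: J_B.
- by move=> y; rewrite (J_comm _ hw)// J_comm.
rewrite dyadicD in hzw *.
apply: le_trans (ler_wpM2l _ (J_add hz hw hzw uv vq)) _.
  by rewrite mulr_ge0// exprn_ge0// (le_trans ler01).
have -> : c ^+ (2 ^ k) = expR (g * (modc z + modc w)).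
  by rewrite /c mulrDr expRD exprMn !rhoX -expRD -mulrDr.
rewrite !modc_dyadic.
set E := expR (2 * g * _).
have hE : E <= expR (2 * g * (modc z + modc w)).
  rewrite /E ler_expR ler_wpM2l ?mulr_ge0//.
  have k1 : (2 ^+ k)^-1 <= 1 :> R by rewrite invf_le1// exprn_ege1// ler1n.
  by rewrite lerD// ler_piMr// modc_ge0.
have -> : 3 * g * (modc z + modc w) = g * (modc z + modc w) + 2 * g * (modc z + modc w).
  by ring.
rewrite expRD natrX.
have -> : 2 ^+ k * expR (g * (modc z + modc w)) *
  (modc z / 2 ^+ k * (modc w / 2 ^+ k) * E * N q) =
  modc z * modc w * (expR (g * (modc z + modc w)) * E) * N q / 2 ^+ k.
  by field; rewrite gt_eqF.
rewrite ler_wpM2r ?invr_ge0 ?(ltW p)// ler_wpM2r ?rnorm_ge0//.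
by rewrite ler_wpM2l ?mulr_ge0 ?modc_ge0// ler_wpM2l// ltW ?expR_gt0.
Qed.

Definition kap z : R := modc z ^+ 2 * expR (3 * g * modc z).

Lemma kap_ge0 z : 0 <= kap z.
Proof. by rewrite mulr_ge0// ?exprn_ge0 ?modc_ge0// ltW ?expR_gt0. Qed.

Lemma modc_half z : modc (z / 2) = modc z / 2.
Proof. by rewrite modcM modcV modc_nat. Qed.

(** The scheme of level k + 1 for z is the scheme of level k for z / 2 run twice, so [euler_add]
    applies to z / 2 + z / 2. *)
Lemma euler_step k z u v q : half_disc (dyadic k z) -> G u v -> G v q ->
  N (euler k.+1 z u - euler k z u) <= kap z * N q / 2 ^+ k.
Proof.
move=> hz uv vq.
have e : dyadic k.+1 z = dyadic k (z / 2).
  by rewrite /dyadic expnS natrM invfM mulrA.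
have hz2 : half_disc (dyadic k (z / 2)) by rewrite -e; apply: (dyadic_half hz).
have -> : euler k.+1 z u = euler k (z / 2) (euler k (z / 2) u).
  by rewrite /euler e expnS mul2n -addnn iterD.
rewrite {3}(splitr z).
apply: le_trans (euler_add hz2 hz2 _ uv vq) _; first by rewrite -splitr.
rewrite !modc_half -splitr ler_wpM2r ?invr_ge0 ?exprn_ge0//.
rewrite ler_wpM2r ?rnorm_ge0// ler_wpM2r// ?(ltW (expR_gt0 _))//.
have := modc_ge0 z; nra.
Qed.

Lemma euler_cauchy k j z u v q : half_disc (dyadic k z) -> G u v -> G v q ->
  N (euler (k + j) z u - euler k z u) <= 2 * kap z * N q / 2 ^+ k.
Proof.
move=> hz uv vq.
have p i : 0 < (2 ^+ i)^-1 :> R by rewrite invr_gt0 exprn_gt0.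
have K0 : 0 <= kap z * N q by rewrite mulr_ge0 ?kap_ge0 ?rnorm_ge0.
(* The partial geometric sum, with its factor 1 - 2^-j, is what the induction on j can carry. *)
suff h : N (euler (k + j) z u - euler k z u) <=
    2 * (kap z * N q) / 2 ^+ k * (1 - (2 ^+ j)^-1).
  apply: (le_trans h); rewrite -[2 * kap z * N q]mulrA ler_piMr//.
    by rewrite mulr_ge0 ?(ltW (p _))// mulr_ge0.
elim: j => [|j IH].
  by rewrite addn0 subrr rnorm0// expr0 invr1 subrr mulr0.
rewrite addnS; apply: le_trans (rdist_tri NN (euler (k + j) z u) _ _) _.
have hj : half_disc (dyadic (k + j) z) by apply: (dyadic_half hz); rewrite leq_addr.
apply: le_trans (lerD (euler_step hj uv vq) IH) _.
rewrite exprS exprD !invfM.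
have := p k; have := p j; set a := (2 ^+ k)^-1; set b := (2 ^+ j)^-1 => b0 a0.
have -> : 2 * (kap z * N q) * a * (1 - 2^-1 * b) =
  kap z * N q * (a * b) + 2 * (kap z * N q) * a * (1 - b).
  by field.
by [].
Qed.

(** Compares the iterates of [J] with those of the identity through [iter_dist], one step being
    [J_dist]. *)
Lemma euler_dist k z u v : half_disc (dyadic k z) -> G u v ->
  N (euler k z u - u) <= modc z * expR (2 * g * modc z) * N v.
Proof.
move=> hz uv.
have c1 : 1 <= rho (dyadic k z) by [].
have iid x n : iter n id x = x by elim: n.
have hQ y : N (id y) <= rho (dyadic k z) * N y by rewrite ler_peMl// rnorm_ge0.
have := @iter_dist _ _ _ NN _ id _ (2 ^ k) u c1 (J_B hz) (fun _ _ => erefl)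
  (fun _ => erefl) (fun y => hpr_bound HJ y hz) hQ.
rewrite iid => /le_trans; apply.
apply: le_trans (ler_wpM2l _ (J_dist hz uv)) _.
  by rewrite mulr_ge0// exprn_ge0// (le_trans ler01).
rewrite /rho rhoX.
have h : expR (g * modc (dyadic k z)) <= expR (g * modc z).
  rewrite ler_expR ler_wpM2l// modc_dyadic ler_piMr ?modc_ge0//.
  by rewrite invf_le1// ?exprn_gt0// exprn_ege1// ler1n.
rewrite -[2 * g * _]mulrA mulr2n mulrDl mul1r expRD modc_dyadic natrX.
move: h; rewrite modc_dyadic; set a := expR (g * _); set b := expR (g * _) => h.
have -> : 2 ^+ k * b * (modc z / 2 ^+ k * a * N v) = modc z * (b * a) * N v.
  by field.
by rewrite ler_wpM2r ?rnorm_ge0// ler_wpM2l ?modc_ge0// ler_wpM2l// ltW ?expR_gt0.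
Qed.

(* Yosida-type approximants of the identity with values in the domain. *)
Definition appr j x : X := J (toC (r / 2 ^+ j)) x.

Lemma modc_appr j : modc (toC (r / 2 ^+ j)) = r / 2 ^+ j.
Proof. by rewrite modc_toC// divr_ge0// ?exprn_ge0// ltW. Qed.

Lemma half_appr j : half_disc (toC (r / 2 ^+ j)).
Proof.
split; first by rewrite /= divr_ge0// ?exprn_ge0// ltW.
rewrite modc_appr ler_piMr ?(ltW r0)//.
by rewrite invf_le1// ?exprn_gt0// exprn_ege1// ler1n.
Qed.

Lemma appr_dom j x : exists v, G (appr j x) v.
Proof.
have p : toC (r / 2 ^+ j) != 0 :> cplx R.
  apply/eqP => /(congr1 (@modc R)); rewrite modc_appr modc0 => /eqP.
  by rewrite gt_eqF// divr_gt0// exprn_gt0.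
by have [v Gv _] := hpr_KJ HJ x (half_appr j) p; exists v.
Qed.

Lemma appr_bound j x : N (appr j x) <= expR (g * r) * N x.
Proof.
apply: le_trans (hpr_bound HJ x (half_appr j)) _.
rewrite ler_wpM2r ?rnorm_ge0// ler_expR ler_wpM2l//.
by have [_] := half_appr j.
Qed.

(** Density argument for a uniformly bounded family: the tolerance e / (1 + |M|) makes both x - u
    and its image under [F n] small. *)
Lemma near_dense (P : set X) (F : nat -> X -> X) M :
  (forall x e, 0 < e -> exists2 u, P u & N (x - u) <= e) ->
  (\forall n \near \oo, {morph F n : x y / x - y} /\
     forall x, N (F n x) <= M * N x) ->
  forall x e, 0 < e -> exists2 u, P u &
    \forall n \near \oo, N (F n x - F n u) <= e /\ N (x - u) <= e.
Proof.
move=> dP FM x e e0.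
have e1 : 0 < e / (1 + `|M|) by rewrite divr_gt0.
have [u Pu xu] := dP x _ e1; exists u => //.
have h : (1 + `|M|) * N (x - u) <= e by rewrite -ler_pdivlMl// mulrC.
have := rnorm_ge0 NN (x - u).
have := ler_norm M; have := normr_ge0 M => M0 M0' xu0.
apply: filterS FM => n [FB FM]; split; last by nra.
rewrite -FB (le_trans (FM _))//; nra.
Qed.

(** On the domain [J_dist] gives convergence at rate 2^-j; the uniform bound and density give the
    rest. *)
Lemma appr_cvg x : ncvg N (appr ^~ x) x.
Proof.
move=> e e0; have e3 : 0 < e / 3 by lra.
have dG y d : 0 < d -> exists2 u, exists v, G u v & N (y - u) <= d.
  by move=> /(hpr_dense HJ y)[u [v [uv h]]]; exists u => //; exists v.
have [] := @near_dense _ appr (expR (g * r)) dG _ x _ e3.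
  near=> n; split; first exact/J_B/half_appr.
  by move=> y; apply: appr_bound.
move=> u [v uv] h.
have K0 : 0 < r * expR (g * r) * N v + 1.
  by rewrite ltr_wpDl// !mulr_ge0 ?rnorm_ge0// ltW// expR_gt0.
have d0 : 0 < e / 3 / (r * expR (g * r) * N v + 1) by rewrite divr_gt0.
have := near_infty_natSinv_expn_lt (PosNum d0) => /= hn.
near=> n.
have [h1 h2] : N (appr n x - appr n u) <= e / 3 /\ N (x - u) <= e / 3 by near: n.
have h3 : 1 / 2 ^+ n < e / 3 / (r * expR (g * r) * N v + 1) by near: n.
have h4 : N (appr n u - u) <= e / 3.
  apply: le_trans (J_dist (half_appr n) uv) _.
  move: h3; rewrite ltr_pdivlMr// mul1r => /ltW; apply: le_trans.
  rewrite modc_appr.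
  have -> : r / 2 ^+ n * rho (toC (r / 2 ^+ n)) * N v =
     (2 ^+ n)^-1 * (r * rho (toC (r / 2 ^+ n)) * N v) by ring.
  rewrite ler_wpM2l ?invr_ge0 ?exprn_ge0//.
  rewrite (le_trans (y := r * expR (g * r) * N v)) ?lerDl//.
  rewrite ler_wpM2r ?rnorm_ge0// ler_wpM2l ?(ltW r0)// ler_expR ler_wpM2l//.
  by have [] := half_appr n.
have := rdist_tri NN (appr n u) (appr n x) x; have := rdist_tri NN u (appr n u) x.
rewrite (rdistC NN u x); lra.
Unshelve. all: by end_near. Qed.

(** Membership of (u, v) in the graph amounts to J s (u - s v) = u for one admissible s != 0, an
    equation between bounded maps that passes to the limit. *)
Lemma graph_closed (u v : nat -> X) x y :
  ncvg N u x -> ncvg N v y -> (\forall n \near \oo, G (u n) (v n)) -> G x y.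
Proof.
move=> ux vy uv; set s : cplx R := toC (r / 2 ^+ 0).
have hs : half_disc s := half_appr 0.
have s0 : s != 0.
  apply/eqP => /(congr1 (@modc R)); rewrite modc_appr modc0 expr0 divr1 => e.
  by have := r0; rewrite e ltxx.
have e : J s (x - s *: y) = x.
  apply: (ncvg_unique NN _ ux).
  apply: ncvg_near (ncvgM NN (fun y => hpr_bound HJ y hs) (J_B hs)
    (ncvgB NN ux (ncvgZ NN s vy))).
  by apply: filterS uv => n uv /=; rewrite (hpr_JK HJ hs uv).
have [v' Gv' e'] := hpr_KJ HJ (x - s *: y) hs s0.
suff -> : y = v' by rewrite -{1}e.
apply: (scalerI s0); apply/oppr_inj/(addrI x).
by rewrite -[LHS]e' e.
Qed.

(** A point u of the domain is smoothed by [appr n]: its image becomes [appr n v], which lies in the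
    domain again. *)
Lemma dense2 x e : 0 < e -> exists u v q, [/\ G u v, G v q & N (x - u) <= e].
Proof.
move=> e0; have e2 : 0 < e / 2 by lra.
have [u [v [uv xu]]] := hpr_dense HJ x e2.
have [n hn] : exists n, N (appr n u - u) <= e / 2.
  by near \oo => n; exists n; near: n; exact: appr_cvg.
have [q vq] := appr_dom n v.
exists (appr n u), (appr n v), q; split=> //.
  by apply: J_graph => //; apply: half_appr.
rewrite (le_trans (rdist_tri NN u _ _))// (rdistC NN u).
lra.
Unshelve. all: by end_near. Qed.

(** * The limit semigroup on the closed right half plane *)

Lemma near_small (c e : R) : 0 < e -> \forall n \near \oo, c / 2 ^+ n <= e.
Proof.
move=> e0; have c1 : 0 < 1 + `|c| by rewrite ltr_wpDr.
have d0 : 0 < e / (1 + `|c|) by rewrite divr_gt0.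
have := near_infty_natSinv_expn_lt (PosNum d0); apply: filterS => n /=.
rewrite ltr_pdivlMr// mul1r => /ltW; apply: le_trans.
rewrite mulrC ler_wpM2l ?invr_ge0 ?exprn_ge0//.
by have := ler_norm c; lra.
Qed.

(** The default [0] matters only where the schemes have no limit, which [flow_cvg] excludes for
    [0 <= Re z]. *)
Definition flow z x : X := xget 0 (ncvg N (fun k => euler k z x)).

(** The schemes are Cauchy on the domain of L^2 by [euler_cauchy]; uniform stability and density
    carry this to every x. *)
Lemma flow_cvg z x : 0 <= Re z -> ncvg N (fun k => euler k z x) (flow z x).
Proof.
move=> z0; suff [l hl] : exists l, ncvg N (fun k => euler k z x) l.
  exact: (xgetI _ hl).
apply: (hpr_complete HJ) => e e0; have e3 : 0 < e / 3 by lra.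
have d2 y d : 0 < d -> exists2 u, (exists v q, G u v /\ G v q) & N (y - u) <= d.
  by move=> /(dense2 y)[u [v [q [uv vq h]]]]; exists u => //; exists v, q.
have [] := @near_dense _ (fun k => euler k z) (rho z) d2 _ x _ e3.
  near=> k; have hk : half_disc (dyadic k z) by near: k; apply: near_dyadic_half.
  by split; [exact: euler_B|move=> y; exact: euler_bound].
move=> u [v [q [uv vq]]] [n0 _ hn0].
near=> n => m nm.
have n0n : (n0 <= n)%N by near: n; exact: nbhs_infty_ge.
have [h1 _] := hn0 n n0n.
have [h2 _] : N (euler m z x - euler m z u) <= e / 3 /\ N (x - u) <= e / 3.
  by apply: hn0; apply: leq_trans nm.
have h3 : N (euler m z u - euler n z u) <= e / 3.
  rewrite -(subnKC nm).
  apply: le_trans (euler_cauchy (m - n) _ uv vq) _.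
    by near: n; apply: near_dyadic_half.
  by near: n; apply: near_small.
have := rdist_tri NN (euler m z u) (euler m z x) (euler n z x).
have := rdist_tri NN (euler n z u) (euler m z u) (euler n z x).
rewrite (rdistC NN (euler n z u)); lra.
Unshelve. all: by end_near. Qed.

Lemma flow_linear z a x y : 0 <= Re z ->
  flow z (a *: x + y) = a *: flow z x + flow z y.
Proof.
move=> z0; apply: (ncvg_unique NN (flow_cvg _ z0)).
apply: ncvg_near (ncvgD NN (ncvgZ NN a (flow_cvg x z0)) (flow_cvg y z0)).
apply: filterS (near_dyadic_half z0) => k hk; by rewrite euler_linear.
Qed.

Lemma flow_B z : 0 <= Re z -> {morph flow z : x y / x - y}.
Proof.
move=> hz x y; rewrite addrC -scaleN1r flow_linear//.
by rewrite scaleN1r addrC.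
Qed.

Lemma flow_Z z k x : 0 <= Re z -> flow z (k *: x) = k *: flow z x.
Proof.
move=> hz; have := flow_linear k x 0 hz; rewrite addr0 => ->.
by have := flow_B hz x x; rewrite !subrr => ->; rewrite addr0.
Qed.

Lemma flow_bound z x : 0 <= Re z -> N (flow z x) <= expR (g * modc z) * N x.
Proof.
move=> z0; apply: (ncvg_norm NN (flow_cvg x z0)).
by apply: filterS (near_dyadic_half z0) => k hk; apply: euler_bound.
Qed.

Lemma flow0 x : flow 0 x = x.
Proof.
have z0 : 0 <= Re (0 : cplx R) by [].
apply: (ncvg_unique NN (flow_cvg x z0)).
apply: ncvg_near (ncvg_cst NN x); near=> k.
rewrite /euler /dyadic mul0r; elim: (2 ^ k)%N => //= n <-.
by rewrite (hpr_J0 HJ).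
Unshelve. all: by end_near. Qed.

Lemma flow_dist z u v : 0 <= Re z -> G u v ->
  N (flow z u - u) <= modc z * expR (2 * g * modc z) * N v.
Proof.
move=> z0 uv; apply: (ncvg_le NN (flow_cvg u z0)).
by apply: filterS (near_dyadic_half z0) => k hk; apply: euler_dist.
Qed.

Lemma flow_graph z u v : 0 <= Re z -> G u v -> G (flow z u) (flow z v).
Proof.
move=> z0 uv; apply: (graph_closed (flow_cvg u z0) (flow_cvg v z0)).
by apply: filterS (near_dyadic_half z0) => k hk; apply: euler_graph.
Qed.

Lemma flow_J z w x : 0 <= Re z -> half_disc w -> flow z (J w x) = J w (flow z x).
Proof.
move=> z0 hw; apply: (ncvg_unique NN (flow_cvg _ z0)).
apply: ncvg_near (ncvgM NN (fun y => hpr_bound HJ y hw) (J_B hw) (flow_cvg x z0)).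
by apply: filterS (near_dyadic_half z0) => k hk; rewrite euler_J.
Qed.

Lemma dense_eq0 (f : X -> X) M : {morph f : x y / x - y} ->
  (forall x, N (f x) <= M * N x) ->
  (forall u v q, G u v -> G v q -> f u = 0) -> forall x, f x = 0.
Proof.
move=> fB fM f0 x; apply/(rnorm0_eq0 NN)/le_anti; rewrite rnorm_ge0// andbT.
apply/ler_addgt0Pr => e e0; rewrite add0r.
have e1 : 0 < e / (1 + `|M|) by rewrite divr_gt0.
have [u [v [q [uv vq xu]]]] := dense2 x e1.
have -> : f x = f (x - u) by rewrite fB (f0 u v q)// subr0.
have h : (1 + `|M|) * N (x - u) <= e by rewrite -ler_pdivlMl// mulrC.
apply: le_trans (fM _) (le_trans _ h); rewrite ler_wpM2r ?rnorm_ge0//.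
by have := ler_norm M; lra.
Qed.

Lemma ReD z w : Re (z + w) = Re z + Re w.
Proof. by case: z => ? ?; case: w. Qed.

Lemma ReN z : Re (- z) = - Re z.
Proof. by case: z. Qed.

(** On the domain of L^2 the defect of the schemes is O(2^-k) by [euler_add]; both sides are bounded
    in x, so [dense_eq0] concludes. *)
Lemma flow_add z w x : 0 <= Re z -> 0 <= Re w -> flow (z + w) x = flow z (flow w x).
Proof.
move=> z0 w0; have zw0 : 0 <= Re (z + w) by rewrite ReD addr_ge0.
apply/eqP; rewrite -subr_eq0; apply/eqP.
apply: (@dense_eq0 (fun x => flow (z + w) x - flow z (flow w x))
    (expR (g * modc (z + w)) + expR (g * modc z) * expR (g * modc w))).
- move=> a b; rewrite !flow_B// opprB addrACA [- _ + _]addrC !opprB.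
  by rewrite [RHS]addrACA -!addrA; congr (_ + _); rewrite addrC -!addrA.
- move=> y; rewrite mulrDl (le_trans (rnormB NN _ _))// lerD ?flow_bound//.
  by rewrite -mulrA (le_trans (flow_bound _ z0))// ler_wpM2l ?flow_bound// expR_ge0.
move=> u v q uv vq; apply/eqP; rewrite subr_eq0; apply/eqP.
apply: (ncvg_unique NN (flow_cvg u zw0)).
move=> e e0; have e3 : 0 < e / 3 by lra.
have d0 : 0 < e / 3 / expR (g * modc z) by rewrite divr_gt0 ?expR_gt0.
near=> k.
have hz : half_disc (dyadic k z) by near: k; apply: near_dyadic_half.
have hw : half_disc (dyadic k w) by near: k; apply: near_dyadic_half.
have hzw : half_disc (dyadic k (z + w)) by near: k; apply: near_dyadic_half.
have h1 : N (euler k (z + w) u - euler k z (euler k w u)) <= e / 3.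
  rewrite rdistC//; apply: le_trans (euler_add hz hw hzw uv vq) _.
  by near: k; apply: near_small.
have h2 : N (euler k z (euler k w u) - euler k z (flow w u)) <= e / 3.
  rewrite -euler_B// (le_trans (euler_bound _ hz))//.
  rewrite mulrC -ler_pdivlMr ?expR_gt0//.
  by near: k; exact: flow_cvg.
have h3 : N (euler k z (flow w u) - flow z (flow w u)) <= e / 3.
  by near: k; exact: flow_cvg.
have := rdist_tri NN (euler k z (euler k w u)) (euler k (z + w) u) (flow z (flow w u)).
have := rdist_tri NN (euler k z (flow w u)) (euler k z (euler k w u)) (flow z (flow w u)).
lra.
Unshelve. all: by end_near. Qed.

(** * Expansion at zero and strong continuity *)

Let K2 := 3 * expR (3 * g * r).

Let K2_ge0 : 0 <= K2. Proof. by rewrite mulr_ge0// expR_ge0. Qed.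

(** A single Euler step is interposed: [euler_cauchy] from level 0 bounds its distance to the flow,
    and J z u - u - z v = z (J z v - v). *)
Lemma flow_taylor z u v q : half_disc z -> G u v -> G v q ->
  N (flow z u - u - z *: v) <= K2 * modc z ^+ 2 * N q.
Proof.
move=> hz uv vq; have [z0 zr] := hz; have m0 := modc_ge0 z.
have q0 := rnorm_ge0 NN q.
have d0 : dyadic 0 z = z by rewrite /dyadic expn0 divr1.
have hz0 : half_disc (dyadic 0 z) by rewrite d0.
have E3 : expR (3 * g * modc z) <= expR (3 * g * r).
  by rewrite ler_expR ler_wpM2l// mulr_ge0.
have E1 : expR (g * modc z) <= expR (3 * g * r).
  rewrite ler_expR (le_trans (ler_wpM2l g0 zr))//.
  by have := mulr_ge0 g0 (ltW r0); lra.
rewrite -addrA -opprD; apply: (ncvg_le NN (flow_cvg u z0)).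
near=> k.
have := @euler_cauchy 0 k z _ _ _ hz0 uv vq.
rewrite add0n expr0 divr1 {2}/euler d0 expn0 /= => h.
apply: le_trans (rdist_tri NN (J z u) _ _) _.
have -> : J z u - (u + z *: v) = z *: (J z v - v).
  by rewrite opprD addrA (J_sub hz uv) scalerBr.
rewrite (rnormZ NN).
have h2 := ler_wpM2l m0 (J_dist hz vq).
apply: le_trans (lerD h h2) _; rewrite /kap /rho.
(* The 3 in [K2] is 2 for the flow against one Euler step and 1 for that step against its
   linearization. *)
have -> : K2 * modc z ^+ 2 * N q = 2 * (modc z ^+ 2 * expR (3 * g * r)) * N q +
   modc z * (modc z * expR (3 * g * r) * N q) by rewrite /K2; ring.
apply: lerD.
  by rewrite ler_wpM2r// ler_wpM2l// ler_wpM2l// exprn_ge0.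
by rewrite ler_wpM2l// ler_wpM2r// ler_wpM2l.
Unshelve. all: by end_near. Qed.

Lemma flow_cvg0 x e : 0 < e ->
  exists2 d, 0 < d & forall z, 0 <= Re z -> modc z < d -> N (flow z x - x) <= e.
Proof.
move=> e0; have e1 : 0 < e / (2 * (expR (g * 1) + 1)).
  by rewrite divr_gt0// mulr_gt0// addr_gt0// expR_gt0.
have [u [v [uv xu]]] := hpr_dense HJ x e1.
have v0 := rnorm_ge0 NN v.
have p : 0 < 2 * (expR (2 * g) * N v + 1).
  by rewrite mulr_gt0// ltr_wpDl// mulr_ge0// expR_ge0.
exists (Num.min 1 (e / (2 * (expR (2 * g) * N v + 1)))).
  by rewrite lt_min ltr01/= divr_gt0.
move=> z z0; rewrite lt_min => /andP[/ltW z1 /ltW]; rewrite ler_pdivlMr// => zd.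
have h1 := flow_dist z0 uv.
have h2 : N (flow z x - flow z u) <= expR (g * 1) * N (x - u).
  rewrite -flow_B// (le_trans (flow_bound _ z0))// ler_wpM2r ?rnorm_ge0//.
  by rewrite ler_expR ler_wpM2l.
have m0 := modc_ge0 z.
have h3 : modc z * expR (2 * g * modc z) * N v <= modc z * (expR (2 * g) * N v).
  rewrite -mulrA ler_wpM2l// ler_wpM2r// ler_expR.
  by rewrite ler_piMr// mulr_ge0.
move: xu; rewrite ler_pdivlMr ?mulr_gt0 ?addr_gt0 ?expR_gt0// => xu.
have := rdist_tri NN (flow z u) (flow z x) x.
have := rdist_tri NN u (flow z u) x.
rewrite (rdistC NN u x); nra.
Qed.

(** * Identification of the generator *)

Definition diff_quot t x : X := (toC t)^-1 *: (flow (toC t) x - x).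

(** The expansion needs the domain of L^2, so x is replaced by [appr j x]. The remainder x - appr j
    x stays in the domain with the small image y - appr j y, and [flow_dist] bounds its difference
    quotient uniformly in t. *)
Lemma flow_generator x y : G x y -> forall e, 0 < e ->
  exists2 d, 0 < d & forall t, 0 < t -> t < d -> N (diff_quot t x - y) <= e.
Proof.
move=> xy e e0; set E := expR (2 * g * r).
have E0 : 0 < E by exact: expR_gt0.
have e1 : 0 < e / (2 * (E + 1)) by rewrite divr_gt0// mulr_gt0// addr_gt0.
have [j hj] : exists j, N (appr j y - y) <= e / (2 * (E + 1)).
  by near \oo => j; exists j; near: j; exact: appr_cvg.
have [q yq] := appr_dom j y.
have xyj : G (appr j x) (appr j y) by apply: J_graph => //; exact: half_appr.
have q0 := rnorm_ge0 NN q.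
have p : 0 < 2 * (K2 * N q + 1) by rewrite mulr_gt0// ltr_wpDl// mulr_ge0.
exists (Num.min r (e / (2 * (K2 * N q + 1)))).
  by rewrite lt_min r0 divr_gt0.
move=> t t0; rewrite lt_min => /andP[/ltW tr /ltW]; rewrite ler_pdivlMr// => td.
have mt : modc (toC t) = t by rewrite modc_toC// ltW.
have ht : half_disc (toC t) by split; rewrite ?mt// /= ltW.
have T0 : toC t != 0 :> cplx R.
  by apply/eqP => /(congr1 (@modc R)); rewrite mt modc0 => t00; rewrite t00 ltxx in t0.
have h1 := flow_taylor ht xyj yq; rewrite mt in h1.
have h2 := flow_dist ht.1 (graphB xy xyj); rewrite mt in h2.
have EE : expR (2 * g * t) <= E by rewrite ler_expR ler_wpM2l// mulr_ge0.
have eq : diff_quot t x - y = (toC t)^-1 *: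
    ((flow (toC t) (x - appr j x) - (x - appr j x)) +
    ((flow (toC t) (appr j x) - appr j x - toC t *: appr j y) +
     toC t *: (appr j y - y))).
  rewrite scalerBr subrKA flow_B ?ht.1//.
  have -> : y = (toC t)^-1 *: (toC t *: y) by rewrite scalerA mulVf// scale1r.
  rewrite -scalerBr; congr (_ *: _).
  rewrite scalerA mulfV// scale1r addrA; congr (_ - _).
  by rewrite addrACA subrK -opprD subrK.
rewrite eq (rnormZ NN) modcV mt ler_pdivrMl//.
apply: le_trans (rnormD NN _ _) _.
apply: le_trans (lerD (lexx _) (rnormD NN _ _)) _.
rewrite (rnormZ NN) mt.
have d0 := rnorm_ge0 NN (appr j y - y).
have h2' : t * expR (2 * g * t) * N (y - appr j y) <= t * (E * N (appr j y - y)).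
  by rewrite rdistC// -mulrA ler_wpM2l ?(ltW t0)// ler_wpM2r.
move: hj; rewrite ler_pdivlMr ?mulr_gt0 ?addr_gt0// => hj.
have s1 : t * (E * N (appr j y - y) + N (appr j y - y)) <= t * (e / 2).
  rewrite ler_wpM2l ?(ltW t0)//; lra.
have s2 : t * (t * (K2 * N q)) <= t * (e / 2).
  rewrite ler_wpM2l ?(ltW t0)//; nra.
lra.
Unshelve. all: by end_near. Qed.

(** Under the bounded map [J s] the difference quotients tend to [J s y], but also to the image v of
    [J s x]. Hence J s y = v and J s (x - s y) = x, which puts x in the domain with image y. *)
Lemma flow_generator_unique x y :
  (forall e, 0 < e -> exists2 d, 0 < d &
     forall t, 0 < t -> t < d -> N (diff_quot t x - y) <= e) -> G x y.
Proof.
move=> hxy; set s : cplx R := toC (r / 2 ^+ 0).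
have hs : half_disc s := half_appr 0.
have s0 : s != 0.
  apply/eqP => /(congr1 (@modc R)); rewrite modc_appr modc0 expr0 divr1 => e.
  by have := r0; rewrite e ltxx.
have [v Gv ev] := hpr_KJ HJ x hs s0.
have Jy : J s y = v.
  apply/eqP; rewrite -subr_eq0; apply/eqP/(rnorm0_eq0 NN)/le_anti.
  rewrite rnorm_ge0// andbT; apply/ler_addgt0Pr => e e0; rewrite add0r.
  have c0 : 0 < expR (g * modc s) by exact: expR_gt0.
  have e1 : 0 < e / (2 * expR (g * modc s)) by rewrite divr_gt0// mulr_gt0.
  have e2 : 0 < e / 2 by lra.
  have [d1 d10 hd1] := hxy _ e1.
  have [d2 d20 hd2] := flow_generator Gv e2.
  pose t := Num.min d1 d2 / 2.
  have m0 : 0 < Num.min d1 d2 by rewrite lt_min d10 d20.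
  have t0 : 0 < t by rewrite divr_gt0.
  have : t < Num.min d1 d2 by rewrite /t; lra.
  rewrite lt_min => /andP[td1 td2].
  have h1 := hd1 t t0 td1; have h2 := hd2 t t0 td2.
  have e3 : diff_quot t (J s x) = J s (diff_quot t x).
    by rewrite /diff_quot flow_J//= ?(ltW t0)// -J_B// -J_Z.
  have h3 : N (J s (diff_quot t x) - J s y) <= e / 2.
    rewrite -J_B//; apply: le_trans (hpr_bound HJ _ hs) _.
    rewrite mulrC -ler_pdivlMr//; apply: le_trans h1 _.
    by rewrite invfM mulrA [e / 2]mulrC -!mulrA.
  rewrite e3 in h2.
  have := rdist_tri NN (J s (diff_quot t x)) (J s y) v.
  rewrite (rdistC NN (J s y) (J s (diff_quot t x))); lra.
have [w Gw ew] := hpr_KJ HJ (x - s *: y) hs s0.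
have eJ : J s (x - s *: y) = x by rewrite J_B// J_Z// Jy ev.
suff -> : y = w by rewrite -{1}eJ.
apply: (scalerI s0); apply/oppr_inj/(addrI x).
by rewrite -[LHS]ew eJ.
Qed.

(** * Smoothing and complex differentiability *)

Definition smoothing : Prop := forall t, 0 < t -> exists K,
  \forall k \near \oo, forall u v, G u v -> N (euler k (toC t) v) <= K * N u.

Hypothesis HS : smoothing.

(** In [smoothing], v is L u, so the hypothesis bounds L S(t) on the domain, uniformly over fine
    schemes. For general x the vectors S(t) L (appr j x) are Cauchy, and closedness of the graph
    identifies their limit as L S(t) x. *)
Lemma flow_smoothing t : 0 < t -> exists2 K, 0 <= K &
  forall x, exists2 y, G (flow (toC t) x) y & N y <= K * N x.
Proof.
move=> t0; have tR : 0 <= Re (toC t) by rewrite /= ltW.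
have [K hK] := HS t0.
have hF u v : G u v -> N (flow (toC t) v) <= `|K| * N u.
  move=> uv; apply: (ncvg_norm NN (flow_cvg v tR)).
  apply: filterS hK => k hk; apply: le_trans (hk _ _ uv) _.
  by rewrite ler_wpM2r ?rnorm_ge0// ler_norm.
exists (`|K| * expR (g * r)); first by rewrite mulr_ge0// expR_ge0.
move=> x; have [v hv] := choice (fun j => appr_dom j x).
have [y hy] : exists y, ncvg N (fun j => flow (toC t) (v j)) y.
  apply: (hpr_complete HJ) => e e0.
  have d0 : 0 < e / (1 + `|K|) / 2 by rewrite !divr_gt0.
  have [n0 _ hn0] := appr_cvg x d0.
  exists n0 => // n /= n0n m nm.
  rewrite -flow_B//; apply: le_trans (hF _ _ (graphB (hv m) (hv n))) _.
  have h1 := hn0 n n0n; have h2 := hn0 m (leq_trans n0n nm).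
  have h : N (appr m x - appr n x) <= e / (1 + `|K|).
    apply: le_trans (rdist_tri NN x _ _) _; rewrite (rdistC NN x).
    by move: h1 h2 => /=; lra.
  move: h; rewrite ler_pdivlMr//.
  have := rnorm_ge0 NN (appr m x - appr n x); have := normr_ge0 K; nra.
exists y.
  apply: (graph_closed _ hy (u := fun j => flow (toC t) (appr j x))).
    exact: (ncvgM NN (fun y => flow_bound y tR) (flow_B tR) (appr_cvg x)).
  by near=> j; apply: flow_graph.
apply: (ncvg_norm NN hy); near=> j.
apply: le_trans (hF _ _ (hv j)) _.
by rewrite -mulrA ler_wpM2l// appr_bound.
Unshelve. all: by end_near. Qed.

(** If Re h >= 0, S(z) factors out and [flow_taylor] applies to h. Otherwise S(w) with w = z + h
    factors out, and the expansion is read backwards along k = - h. *)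
Lemma flow_remainder z h u v q : 0 <= Re z -> 0 <= Re (z + h) -> modc h <= r ->
  G u v -> G v q ->
  N (flow (z + h) u - flow z u - h *: flow z v) <=
  expR (g * (modc z + r)) * (K2 + expR (2 * g * r)) * modc h ^+ 2 * N q.
Proof.
move: (@flow_taylor) K2_ge0; move: K2 => L taylor L0 z0 zh0 hr uv vq.
have q0 := rnorm_ge0 NN q; have m0 := modc_ge0 h.
set E := expR (g * (modc z + r)); set F := expR (2 * g * r).
have F0 : 0 <= F by exact: expR_ge0.
have [h0|/ltW h0] := leP 0 (Re h).
  have hh : half_disc h by [].
  rewrite flow_add// -flow_Z// -!flow_B// -!mulrA.
  apply: le_trans (flow_bound _ z0) _; apply: ler_pM; rewrite ?expR_ge0 ?rnorm_ge0//.
    by rewrite ler_expR ler_wpM2l// lerDl ltW.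
  apply: le_trans (taylor _ _ _ _ hh uv vq) _.
  by rewrite expr2 -!mulrA ler_wpM2r ?mulr_ge0// lerDl.
have [k [w [ez eh ew]]] : exists k w, [/\ z = w + k, h = - k & w = z + h].
  by exists (- h), (z + h); rewrite addrK opprK.
have ek : k = - h by rewrite eh opprK.
have k0 : 0 <= Re k by rewrite ek ReN oppr_ge0.
have kr : modc k <= r by rewrite ek modcN.
have hk : half_disc k by [].
have wz : modc w <= modc z + r.
  by rewrite ew; apply: le_trans (modcD _ _) _; rewrite lerD2l.
rewrite -ew in zh0.
rewrite -ew {1 2}ez eh modcN scaleNr opprK !flow_add// -flow_Z// -!flow_B//.
(* The backward remainder is k (S(k) v - v), bounded by [flow_dist], minus the forward Taylor
   remainder at k. *)
have -> : flow w (u - flow k u) + flow w (k *: flow k v) =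
    flow w (k *: (flow k v - v) - (flow k u - u - k *: v)).
  rewrite -[flow w (u - _)]scale1r -flow_linear// scale1r; congr flow.
  by rewrite scalerBr opprB subrKA opprB addrC.
apply: le_trans (flow_bound _ zh0) _.
rewrite -!mulrA; apply: ler_pM; rewrite ?expR_ge0 ?rnorm_ge0//.
  by rewrite ler_expR ler_wpM2l.
apply: le_trans (rnormB NN _ _) _; rewrite (rnormZ NN).
have mk := modc_ge0 k.
have h1 := taylor _ _ _ _ hk uv vq; have h2 := flow_dist k0 vq.
have h3 : expR (2 * g * modc k) <= F by rewrite ler_expR ler_wpM2l// mulr_ge0.
have h4 : modc k * N (flow k v - v) <= modc k ^+ 2 * F * N q.
  rewrite expr2 -!mulrA ler_wpM2l// (le_trans h2)// -mulrA ler_wpM2l//.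
  by rewrite ler_wpM2r.
lra.
Qed.

(* S(z) = S(z - 2t) S(t) S(t) gains two powers of the generator for t = Re z / 3. *)
Lemma flow_derivable z : 0 < Re z -> exists D K,
  [/\ forall x, G (flow z x) (D x), forall x, N (D x) <= K * N x &
  exists2 d, 0 < d & forall h, modc h < d -> forall x,
    N (flow (z + h) x - flow z x - h *: D x) <= K * modc h ^+ 2 * N x].
Proof.
move=> z0; pose t := Re z / 3; have t0 : 0 < t by rewrite divr_gt0.
have tR : 0 <= Re (toC t) by rewrite /= ltW.
have [K K0 hK] := flow_smoothing t0.
(* Here Re z1 = t, so any h with |h| < t keeps z1 + h in the right half plane. *)
pose z1 := z - toC (2 * t).
have ez : z = z1 + (toC t + toC t).
  by rewrite /z1 /toC -rmorphD/= mulr2n mulrDl mul1r subrK.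
have Rz1 : Re z1 = t.
  have : Re z = Re (z1 + (toC t + toC t)) by rewrite -ez.
  rewrite !ReD /= /t; lra.
have z10 : 0 <= Re z1 by rewrite Rz1 ltW.
have tt0 : 0 <= Re (toC t + toC t) by rewrite ReD addr_ge0.
(* The two components are L S(2t) x and L^2 S(2t) x, each power of L being paid for by one factor
   S(t). *)
have hx x : exists p : X * X, [/\ G (flow (toC t + toC t) x) p.1, G p.1 p.2,
    N p.1 <= expR (g * modc (toC t)) * (K * N x) & N p.2 <= K * K * N x].
  have [y1 xy1 Ny1] := hK x; have [y2 y12 Ny2] := hK y1.
  exists (flow (toC t) y1, y2); split=> //=.
  - by rewrite flow_add//; apply: flow_graph.
  - by apply: le_trans (flow_bound _ tR) _; rewrite ler_wpM2l ?expR_ge0.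
  - by apply: le_trans Ny2 _; rewrite -mulrA ler_wpM2l.
have [p hp] := choice hx.
pose K3 := expR (g * modc z1) * (expR (g * modc (toC t)) * K).
pose K4 := expR (g * (modc z1 + r)) * (K2 + expR (2 * g * r)) * (K * K).
have K40 : 0 <= K4 by rewrite !mulr_ge0 ?addr_ge0 ?expR_ge0.
have K30 : 0 <= K3 by rewrite !mulr_ge0 ?expR_ge0.
exists (fun x => flow z1 (p x).1), (K3 + K4); split.
- by move=> x; rewrite {1}ez flow_add//; apply: flow_graph => //; case: (hp x).
- move=> x; have [_ _ h _] := hp x.
  apply: (@le_trans _ _ (K3 * N x)).
    apply: le_trans (flow_bound _ z10) _.
    by rewrite /K3 -!mulrA ler_wpM2l ?expR_ge0.
  by rewrite ler_wpM2r ?rnorm_ge0// lerDl.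
exists (Num.min t r); first by rewrite lt_min t0 r0.
move=> h; rewrite lt_min => /andP[ht /ltW hr] x.
have [h1 h2 _ h3] := hp x.
have z1h : 0 <= Re (z1 + h).
  rewrite ReD Rz1; have := ler_Re_modc (- h); rewrite modcN ReN; lra.
have -> : z + h = z1 + h + (toC t + toC t) by rewrite addrAC -ez.
rewrite {1}ez (flow_add x z1h tt0) (flow_add x z10 tt0).
apply: le_trans (flow_remainder z10 z1h hr h1 h2) _.
have m0 : 0 <= modc h ^+ 2 by rewrite exprn_ge0// modc_ge0.
set A := expR _ * _.
have A0 : 0 <= A by rewrite mulr_ge0 ?addr_ge0 ?expR_ge0.
apply: (@le_trans _ _ (A * modc h ^+ 2 * (K * K * N x))).
  by rewrite ler_wpM2l// mulr_ge0.
have -> : A * modc h ^+ 2 * (K * K * N x) = K4 * modc h ^+ 2 * N x.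
  by rewrite /K4 /A; ring.
by rewrite ler_wpM2r ?rnorm_ge0// ler_wpM2r// lerDr.
Qed.

End Semigroup.

Lemma linear_fun_exists (K : pzRingType) (V W : lmodType K) (f : V -> W) :
  linear f -> exists L : {linear V -> W}, L =1 f.
Proof.
move=> lf; pose L : {linear V -> W} := HB.pack f (GRing.isLinear.Build _ _ _ _ f lf).
by exists L.
Qed.

(** * Passage between complex-valued and real-valued norms *)

Section NormValue.
Context (R : realType) (V : normedModType (cplx R)).
Implicit Types x y : V.

(* Norms over the field R[i] take their values in R[i]. *)
Definition rnm x : R := Re `|x|.

Lemma rnmE x : `|x| = toC (rnm x).
Proof.
by have := normr_ge0 x; rewrite /rnm; case: `|x| => a b; rewrite lecE /= => /andP[/eqP -> _].
Qed.

Lemma toC_gt0 (e : cplx R) : 0 < e -> exists2 d : R, 0 < d & e = toC d.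
Proof. by case: e => a b; rewrite ltcE /= => /andP[/eqP -> a0]; exists a. Qed.

Lemma toCM (a b : R) : toC (a * b) = toC a * toC b.
Proof. by rewrite /toC rmorphM. Qed.

Lemma toCD (a b : R) : toC (a + b) = toC a + toC b.
Proof. by rewrite /toC rmorphD. Qed.

Lemma ler_toC (a b : R) : (toC a <= toC b) = (a <= b).
Proof. exact: lecR. Qed.

Lemma ltr_toC (a b : R) : (toC a < toC b) = (a < b).
Proof. exact: ltcR. Qed.

Lemma rnm_real_norm : real_norm rnm.
Proof.
split=> [x y|k x|x].
- by rewrite -ler_toC toCD -!rnmE ler_normD.
- by rewrite /rnm normrZ norm_modc Re_toCM.
- by move=> x0; apply/eqP; rewrite -normr_eq0 rnmE x0.
Qed.

End NormValue.

(** * Generation of an analytic semigroup from the abstract estimates *)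

Section Generation.
Context (R : realType) (X : normedModType (cplx R)) (T : operator X X)
  (N : X -> R) (J : cplx R -> X -> X) (r g c1 c2 : R).
Hypothesis HJ : half_plane_resolvent N (graph T) J r g.
Hypothesis HS : smoothing N (graph T) J.
Hypothesis (c10 : 0 < c1) (c20 : 0 < c2).
Hypothesis N_le : forall x, N x <= c1 * rnm x.
Hypothesis le_N : forall x, rnm x <= c2 * N x.

Let NN := hpr_norm HJ.

Lemma sector_Re (z : cplx R) : sector (pi / 2) z -> 0 < Re z.
Proof.
move=> [s [phi [s0 hphi ->]]] /=; rewrite mulr_gt0// cos_gt0_pihalf//.
by move: hphi; rewrite ltr_norml.
Qed.

(** Passing to the equivalent norm [N] and back costs the factor [c1 * c2]. *)
Let normNX x y c : 0 <= c -> N x <= c * N y -> `|x| <= toC (c2 * (c * c1)) * `|y|.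
Proof.
move=> c0 h; rewrite !rnmE -toCM ler_toC (le_trans (le_N _))//.
rewrite -!mulrA ler_wpM2l ?(ltW c20)// (le_trans h)// ler_wpM2l//.
Qed.

(** The flow lives on the whole right half plane, so the sector has the maximal angle pi / 2. *)
Theorem half_plane_generates : generates_analytic_semigroup T.
Proof.
have [S hS] : exists S : cplx R -> {linear X -> X},
    forall z, 0 <= Re z -> S z =1 flow N J z.
  have h (z : cplx R) : exists L : {linear X -> X}, 0 <= Re z -> L =1 flow N J z.
    have [z0|z0] := boolP (0 <= Re z).
      have [L hL] : exists L : {linear X -> X}, L =1 flow N J z.
        by apply: linear_fun_exists => a x y; exact: (flow_linear HJ).
      by exists L => _.
    (* Off the closed half plane the identity serves as a default linear map. *)
    by exists idfun.
  by have [S hS] := choice h; exists S.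
have sec (z : cplx R) : sector (pi / 2) z -> 0 <= Re z by move=> h; apply: ltW; exact: (sector_Re h).
exists (pi / 2), S; split; first by rewrite divr_gt0 ?pi_gt0/=.
- split.
  + move=> z /sec z0; exists (toC (c2 * (expR (g * modc z) * c1))) => x.
    by rewrite hS//; apply: normNX; rewrite ?expR_ge0// (flow_bound HJ).
  + by move=> x; rewrite hS// (flow0 HJ).
  + move=> z w /sec z0 /sec w0 x; rewrite !hS// ?ReD ?addr_ge0//.
    exact: (flow_add HJ).
  + move=> z zsec; have z0 := sector_Re zsec.
    have [D [K [GD DK [d d0 hd]]]] := flow_derivable HJ HS z0.
    (* [D] was obtained by choice; its linearity comes from uniqueness of images in the graph. *)
    have Dlin : linear D.
      move=> a x y; apply: (hpr_fun HJ (GD _)).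
      rewrite (flow_linear HJ) ?(ltW z0)//.
      exact: (hpr_linear HJ).
    have [L hL] := linear_fun_exists Dlin.
    exists L.
      exists (toC (c2 * (`|K| * c1))) => x; rewrite hL; apply: normNX => //.
      by rewrite (le_trans (DK x))// ler_wpM2r ?(rnorm_ge0 NN)// ler_norm.
    move=> e /toC_gt0[e' e0 ->].
    pose M := c2 * ((`|K| + 1) * c1).
    have M0 : 0 < M by rewrite !mulr_gt0// ltr_wpDl.
    (* The bound [Re z] keeps z + h in the half plane, and [e' / M] brings the quadratic remainder,
       divided by |h|, below [e']. *)
    pose dd := Num.min (Num.min d (Re z)) (e' / M).
    have dd0 : 0 < dd by rewrite !lt_min d0 z0 divr_gt0.
    near=> h => x.
    have h0 : h != 0 by near: h; exact: nbhs_dnbhs_neq.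
    have hdd : modc h < dd.
      rewrite -ltr_toC -norm_modc; near: h; apply: dnbhs0_lt.
      by rewrite -[0]/(toC 0) ltr_toC.
    move: hdd; rewrite !lt_min => /andP[/andP[hd1 hz]].
    rewrite ltr_pdivlMr// => /ltW hM.
    have zh0 : 0 <= Re (z + h).
      by rewrite ReD; have := ler_Re_modc (- h); rewrite modcN ReN; lra.
    have m0 : 0 < modc h.
      by rewrite lt_neqAle modc_ge0 eq_sym andbT; apply: contra h0 => /eqP /(@Normc.eq0_normc R) ->.
    rewrite !hS ?(ltW z0)// hL.
    have -> : h^-1 *: (flow N J (z + h) x - flow N J z x) - D x =
        h^-1 *: (flow N J (z + h) x - flow N J z x - h *: D x).
      by rewrite [RHS]scalerBr scalerA mulVf// scale1r.
    apply: (@le_trans _ _ (toC (c2 * ((`|K| + 1) * modc h * c1)) * `|x|)).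
      apply: normNX; first by rewrite mulr_ge0 ?modc_ge0// addr_ge0.
      rewrite (rnormZ NN) modcV ler_pdivrMl//.
      apply: le_trans (hd h hd1 x) _.
      have -> : modc h * ((`|K| + 1) * modc h * N x) = (`|K| + 1) * modc h ^+ 2 * N x.
        by ring.
      rewrite ler_wpM2r ?(rnorm_ge0 NN)// ler_wpM2r ?exprn_ge0 ?modc_ge0//.
      by have := ler_norm K; lra.
    rewrite ler_wpM2r// ler_toC; move: hM; rewrite /M.
    by have -> : c2 * ((`|K| + 1) * modc h * c1) = modc h * (c2 * ((`|K| + 1) * c1)) by ring.
  + move=> x; apply/cvgrPdist_le => e /toC_gt0[e' e0 ->].
    have e1 : 0 < e' / c2 by rewrite divr_gt0.
    have [d d0 hd] := flow_cvg0 HJ x e1.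
    near=> z.
    have /sec z0 : sector (pi / 2) z by near: z; exact: withinT.
    have hz : modc z < d.
      rewrite -ltr_toC -norm_modc; near: z; apply: cvg_within.
      suff : \forall z \near (0 : cplx R), `|z| < toC d by [].
      by apply: nbhs0_lt; rewrite -[0]/(toC 0) ltr_toC.
    rewrite hS// distrC rnmE ler_toC (le_trans (le_N _))//.
    by rewrite -ler_pdivlMl// mulrC hd.
move=> x y; split.
- move=> xy; apply/cvgrPdist_le => e /toC_gt0[e' e0 ->].
  have e1 : 0 < e' / c2 by rewrite divr_gt0.
  have [d d0 hd] := flow_generator HJ xy e1.
  near=> t.
  have t0 : 0 < t by near: t; exact: nbhs_right_gt.
  have td : t < d by near: t; exact: nbhs_right_lt.
  rewrite distrC rnmE ler_toC (le_trans (le_N _))//.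
  by rewrite -ler_pdivlMl// mulrC hS ?(ltW t0)//; apply: hd.
move=> /cvgrPdist_le hc; apply: (flow_generator_unique HJ) => e e0.
have e1 : 0 < toC (e / c1) :> cplx R by rewrite -[0]/(toC 0) ltr_toC divr_gt0.
have [d /= d0 hd] := hc _ e1; exists d => // t t0 td.
have := hd t; rewrite /= sub0r normrN gtr0_norm// => /(_ td t0).
rewrite distrC rnmE ler_toC ler_pdivlMr// mulrC => h.
by rewrite (le_trans (N_le _))//; move: h; rewrite hS ?(ltW t0).
Unshelve. all: by end_near. Qed.

End Generation.

(** * The real part of the inner product *)

Section RealInner.
Context (R : realType) (H : hilbertType R).
Implicit Types x y : H.

Definition rip x y : R := Re (inner x y).

Lemma rip_norm x : rip x x = rnm x ^+ 2.
Proof.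
rewrite /rip -sqr_norm_inner rnmE expr2 -toCM /=.
by rewrite expr2.
Qed.

Lemma Re_conj (z : cplx R) : Re (Num.conj z) = Re z.
Proof. by case: z. Qed.

Lemma ripC x y : rip x y = rip y x.
Proof.
by rewrite /rip hermC expr0 mul1r Re_conj.
Qed.

Lemma ripDl x y z : rip (x + y) z = rip x z + rip y z.
Proof. by rewrite /rip linearDl ReD. Qed.

Lemma ripNl x z : rip (- x) z = - rip x z.
Proof. by rewrite /rip linearNl ReN. Qed.

Lemma ripZl (k : R) x z : rip (toC k *: x) z = k * rip x z.
Proof. by rewrite /rip linearZl_LR Re_toCM. Qed.

Lemma ripDr x y z : rip z (x + y) = rip z x + rip z y.
Proof. by rewrite ripC ripDl ![rip _ z]ripC. Qed.

Lemma ripNr x z : rip z (- x) = - rip z x.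
Proof. by rewrite ripC ripNl ripC. Qed.

Lemma ripZr (k : R) x z : rip z (toC k *: x) = k * rip z x.
Proof. by rewrite ripC ripZl ripC. Qed.

Lemma rnm_sqrD x y : rnm (x + y) ^+ 2 = rnm x ^+ 2 + 2 * rip x y + rnm y ^+ 2.
Proof. by rewrite -!rip_norm ripDl !ripDr (ripC y x); ring. Qed.

Lemma rnm_sqrB x y : rnm (x - y) ^+ 2 = rnm x ^+ 2 - 2 * rip x y + rnm y ^+ 2.
Proof. by rewrite -!rip_norm ripDl !ripDr !(ripNl, ripNr) (ripC y x); ring. Qed.

(** Expands 0 <= |x - k y|^2 and divides by k. *)
Lemma rip_young (k : R) x y : 0 < k ->
  2 * rip x y <= k * rnm y ^+ 2 + rnm x ^+ 2 / k.
Proof.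
move=> k0; have := sqr_ge0 (rnm (x - toC k *: y)).
rewrite rnm_sqrB ripZr -[rnm (_ *: _) ^+ 2]rip_norm ripZl ripZr rip_norm => h.
have -> : 2 * rip x y = (k * (2 * rip x y)) / k by field; rewrite gt_eqF.
have -> : k * rnm y ^+ 2 + rnm x ^+ 2 / k =
    (k * (k * rnm y ^+ 2) + rnm x ^+ 2) / k by field; rewrite gt_eqF.
rewrite ler_wpM2r ?invr_ge0 ?(ltW k0)//; lra.
Qed.

End RealInner.

(** * Accretivity and energy estimates for a positive operator *)

Section Positive.
Context (R : realType) (H : hilbertType R) (A : positive_operator H).
Hypothesis A_selfadjoint : self_adjoint A.
Implicit Types u v w : submod (dom A).

Definition energy u : R := rip (\val u) (A u).

Lemma inner_pos_real u : exists2 p : R, 0 <= p & inner (A u) (\val u) = toC p.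
Proof.
have [->|u0] := eqVneq u 0.
  by exists 0; rewrite // (linear0 (op_fun A)) linear0l.
by have [p p0 ->] := toC_gt0 (pos_opP u0); exists p; rewrite // ltW.
Qed.

Lemma energy_ge0 u : 0 <= energy u.
Proof. by have [p p0 e] := inner_pos_real u; rewrite /energy ripC /rip e. Qed.

(** Positivity makes the pairing of A u with u real, so only the real part of the scalar is seen. *)
Lemma rip_scale_pos (z : cplx R) u : rip (\val u) (z *: A u) = Re z * energy u.
Proof.
have [p p0 e] := inner_pos_real u.
rewrite /energy !(ripC (\val u)) /rip linearZl_LR /= !e.
by rewrite [z * toC p]mulrC Re_toCM mulrC.
Qed.

Lemma rip_sym u v : rip (A u) (\val v) = rip (\val u) (A v).
Proof.
have [_ h] := A_selfadjoint; rewrite /rip.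
by rewrite ((h (\val v) (A v)).1 (ex_intro2 _ _ v erefl erefl)).
Qed.

Lemma energyB u v :
  energy (u - v) = energy u - 2 * rip (\val v) (A u) + energy v.
Proof.
rewrite /energy (linearB (op_fun A)) raddfB /= ripDl !ripDr !ripNl !ripNr.
have -> : rip (\val u) (A v) = rip (\val v) (A u) by rewrite -rip_sym ripC.
by ring.
Qed.

(** In the expansion of the square on the right the cross term is 2 (Re z) [energy u], which is
    nonnegative. *)
Lemma accretive (z : cplx R) u : 0 <= Re z -> rnm (\val u) <= rnm (\val u + z *: A u).
Proof.
move=> z0; have n0 := rnorm_ge0 (rnm_real_norm H).
rewrite -(@ler_pXn2r _ 2)// ?nnegrE// rnm_sqrD rip_scale_pos.
rewrite -addrA lerDl addr_ge0 ?sqr_ge0// mulr_ge0// mulr_ge0//.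
exact: energy_ge0.
Qed.

Lemma telescope_le (F E : nat -> R) c n :
  (forall j, (j < n)%N -> F j.+1 + E j <= F j + c) ->
  F n + \sum_(j < n) E j <= F 0%N + n%:R * c.
Proof.
elim: n => [|n IH] h; first by rewrite big_ord0 mul0r.
rewrite big_ord_recr /= -natr1 mulrDl mul1r.
have := IH (fun j jn => h j (ltnW jn)); have := h n (ltnSn n); lra.
Qed.

(* The discrete analogue of d/dt (t <Aw, w> + |w|^2 / 2k) <= - k t |Aw|^2 + ...
   along the implicit Euler scheme for w' = - k A w + f. *)
Lemma euler_energy (w : nat -> submod (dom A)) (f : nat -> H) (h k F : R) n :
  0 < h -> 0 < k -> 0 <= F ->
  (forall j, (j < n)%N ->
     \val (w j) = \val (w j.+1) - toC h *: (f j.+1 - toC k *: A (w j.+1))) ->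
  (forall j, (j <= n)%N -> rnm (f j) <= F) ->
  (forall j, (j <= n)%N -> rnm (\val (w j)) <= F) ->
  h ^+ 2 * \sum_(j < n) j%:R * rnm (A (w j.+1)) ^+ 2 <=
    (1 + n%:R * h + (n%:R * h) ^+ 2) * F ^+ 2 / k ^+ 2.
Proof.
move=> h0 k0 F0 step fF wF.
set T := n%:R * h.
have n0 := rnorm_ge0 (rnm_real_norm H).
have sq (x : H) : rnm x <= F -> rnm x ^+ 2 <= F ^+ 2.
  by move=> xF; rewrite ler_pXn2r ?nnegrE.
(* The weight j h vanishes at j = 0, so [Phi 0] involves only the norm of the initial value, not its
   energy. *)
pose Phi j := j%:R * h * energy (w j) + rnm (\val (w j)) ^+ 2 / (2 * k).
have key j : (j < n)%N ->
    Phi j.+1 + k * h ^+ 2 * (j%:R * rnm (A (w j.+1)) ^+ 2) <=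
    Phi j + h * (1 + T) * F ^+ 2 / k.
  move=> jn; have st := step j jn.
  set d := f j.+1 - toC k *: A (w j.+1) in st.
  set a := rnm (A (w j.+1)) ^+ 2.
  have f2 := sq _ (fF j.+1 jn); have w2 := sq _ (wF j.+1 jn).
  (* Pairs the scheme with w_(j+1); the square |h d|^2 has a favourable sign and is dropped. *)
  have e1 : rnm (\val (w j.+1)) ^+ 2 <=
      rnm (\val (w j)) ^+ 2 - 2 * h * k * energy (w j.+1) + 2 * h * F ^+ 2.
    rewrite [rnm (\val (w j))]/(rnm _) st rnm_sqrB ripZr ripDr ripNr ripZr -/(energy _).
    have := rip_young (\val (w j.+1)) (f j.+1) ltr01.
    have := sqr_ge0 (rnm (toC h *: d)); nra.
  have ed : \val (w j.+1 - w j) = toC h *: d by rewrite raddfB /= st subKr.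
  (* Pairs the scheme with A w_(j+1). The inequality of Young with weight k absorbs half of the
     dissipation 2 h k |A w|^2. *)
  have e2 : energy (w j.+1) <= energy (w j) - h * k * a + h * F ^+ 2 / k.
    have -> : w j = w j.+1 - (w j.+1 - w j) by rewrite subKr.
    rewrite energyB ed ripZl ripDl ripNl ripZl rip_norm -/a.
    have h1 := rip_young (f j.+1) (A (w j.+1)) k0; rewrite -/a in h1.
    have h2 : rnm (f j.+1) ^+ 2 / k <= F ^+ 2 / k.
      by rewrite ler_wpM2r ?invr_ge0// ltW.
    have h3 := energy_ge0 (w j.+1 - w j).
    have -> : h * F ^+ 2 / k = h * (F ^+ 2 / k) by rewrite mulrA.
    move: h2; set y := F ^+ 2 / k => h2.
    nra.
  have jT : j%:R * h <= T by rewrite ler_wpM2r ?(ltW h0)// ler_nat ltnW.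
  have jh0 : 0 <= j%:R * h by rewrite mulr_ge0// ltW.
  have e3 := ler_wpM2l jh0 e2.
  (* From j to j + 1 the weight grows by h; the resulting h [energy (w j.+1)] is cancelled by this
     decrease, hence the coefficient 1 / (2 k) in [Phi]. *)
  have e4 : rnm (\val (w j.+1)) ^+ 2 / (2 * k) <=
     rnm (\val (w j)) ^+ 2 / (2 * k) - h * energy (w j.+1) + h * (F ^+ 2 / k).
    have -> : rnm (\val (w j)) ^+ 2 / (2 * k) - h * energy (w j.+1) + h * (F ^+ 2 / k) =
      (rnm (\val (w j)) ^+ 2 - 2 * h * k * energy (w j.+1) + 2 * h * F ^+ 2) / (2 * k).
      by field; rewrite gt_eqF.
    by rewrite ler_wpM2r// invr_ge0 mulr_ge0// ltW.
  have y0 : 0 <= F ^+ 2 / k by rewrite divr_ge0 ?sqr_ge0// ltW.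
  have e5 : j%:R * h * (h * (F ^+ 2 / k)) <= T * (h * (F ^+ 2 / k)).
    by rewrite ler_wpM2r// mulr_ge0// ltW.
  rewrite /Phi -natr1.
  have -> : h * (1 + T) * F ^+ 2 / k = h * (F ^+ 2 / k) + T * (h * (F ^+ 2 / k)).
    by ring.
  have e6 : h * F ^+ 2 / k = h * (F ^+ 2 / k) by rewrite mulrA.
  rewrite e6 in e3; move: e3 e4 e5; set y := F ^+ 2 / k; lra.
have := telescope_le key; rewrite -mulr_sumr => tel.
have P0 : Phi 0%N <= F ^+ 2 / (2 * k).
  rewrite /Phi mul0r mul0r add0r ler_wpM2r ?invr_ge0 ?mulr_ge0// ?(ltW k0)//.
  exact/sq/wF.
have Pn : 0 <= Phi n.
  rewrite addr_ge0 ?mulr_ge0 ?energy_ge0 ?sqr_ge0 ?(ltW h0)//.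
  by rewrite invr_ge0 mulr_ge0// ltW.
rewrite ler_pdivlMr ?exprn_gt0//.
set S := \sum_(j < n) _ in tel *.
have t1 : k * h ^+ 2 * S <= F ^+ 2 / (2 * k) + n%:R * (h * (1 + T) * F ^+ 2 / k).
  by apply: le_trans (le_trans tel _); [rewrite lerDr|rewrite lerD2r].
have := ler_wpM2l (ltW k0) t1.
have -> : k * (F ^+ 2 / (2 * k) + n%:R * (h * (1 + T) * F ^+ 2 / k)) =
   F ^+ 2 / 2 + T * (1 + T) * F ^+ 2 by rewrite /T; field; rewrite gt_eqF.
have := sqr_ge0 F; lra.
Qed.

End Positive.

(** * Completeness and elementary inequalities *)

Lemma hilbert_ncomplete (R : realType) (H : hilbertType R) : ncomplete (@rnm R H).
Proof.
move=> u uC; have : cauchy_ex (u @ \oo).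
  move=> e /toC_gt0[d d0 ->]; have d2 : 0 < d / 2 by rewrite divr_gt0.
  have [n _ hn] := uC _ d2; exists (u n).
  exists n => // m /= nm; rewrite -ball_normE /= distrC rnmE ltr_toC.
  by rewrite (le_lt_trans (hn n (leqnn n) m nm))//; lra.
move=> /cauchy_exP/cauchy_cvg ul; exists (lim (u @ \oo)) => e e0.
have e1 : 0 < toC e :> cplx R by rewrite -[0]/(toC 0) ltr_toC.
move/cvgrPdist_le : ul => /(_ _ e1); apply: filterS => n.
by rewrite distrC rnmE ler_toC.
Qed.

(** Rests on 1 / (1 - y) <= 1 + 2 y for 0 <= y <= 1/2. *)
Lemma absorb_le (R : realFieldType) (y p q : R) :
  0 <= y -> y <= 2^-1 -> 0 <= p -> p <= q + y * p -> p <= (1 + 2 * y) * q.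
Proof.
move=> y0 y1 p0 h.
have y2 : 0 <= 1 + 2 * y by lra.
have h1 := ler_wpM2l y2 h.
have h2 : 0 <= p * (y * (1 - 2 * y)) by rewrite !mulr_ge0//; lra.
lra.
Qed.

Lemma toC_neq0 (R : realType) (x : R) : x != 0 -> toC x != 0.
Proof. by apply: contra => /eqP/complexI ->. Qed.

Lemma Re_ge0_not_lt0 (R : realType) (z : cplx R) : 0 <= Re z -> ~ (z < 0).
Proof. by case: z => x y /= x0; rewrite ltcE /= => /andP[_]; rewrite ltNge x0. Qed.

(** Squares the bounds on Y and averages them with weights j, which turns weighted square sums into
    a bound on Y itself. The 12 is 3, from the square of a three-term sum, times 4, from the total
    weight being at least t^2 / 4. *)
Lemma weighted_average_le (R : realFieldType) n (h t Y M D W : R) (P S : nat -> R) :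
  (2 <= n)%N -> 0 < h -> n%:R * h = t -> 0 <= Y -> 0 <= M ->
  (forall j, (j < n)%N -> Y <= M * (D + P j + S j)) ->
  h ^+ 2 * \sum_(j < n) j%:R * P j ^+ 2 <= W ->
  h ^+ 2 * \sum_(j < n) j%:R * S j ^+ 2 <= W ->
  Y ^+ 2 * t ^+ 2 <= 12 * M ^+ 2 * (D ^+ 2 * t ^+ 2 + 2 * W).
Proof.
move=> n2 h0 nh Y0 M0 YM PW SW.
have gauss m : \sum_(j < m) j%:R = m%:R * (m%:R - 1) / 2 :> R.
  elim: m => [|m IH]; first by rewrite big_ord0 !mul0r.
  by rewrite big_ord_recr /= IH -natr1; field.
have key : Y ^+ 2 * \sum_(j < n) j%:R <= 3 * M ^+ 2 * (D ^+ 2 * \sum_(j < n) j%:R +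
    \sum_(j < n) j%:R * P j ^+ 2 + \sum_(j < n) j%:R * S j ^+ 2).
  rewrite !mulr_sumr -!big_split /= mulr_sumr; apply: ler_sum => j _.
  have h1 : Y ^+ 2 <= M ^+ 2 * (D + P j + S j) ^+ 2.
    rewrite -exprMn ler_pXn2r ?nnegrE ?YM//.
    exact: le_trans (YM j (ltn_ord j)).
  have h2 : (D + P j + S j) ^+ 2 <= 3 * (D ^+ 2 + P j ^+ 2 + S j ^+ 2).
    have := sqr_ge0 (D - P j); have := sqr_ge0 (D - S j).
    have := sqr_ge0 (P j - S j); lra.
  have h3 := ler_wpM2l (sqr_ge0 M) h2.
  have h4 := ler_wpM2l (ler0n R j) (le_trans h1 h3).
  by move: h4; lra.
have key2 := ler_wpM2l (sqr_ge0 h) key.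
have hG : h ^+ 2 * \sum_(j < n) j%:R = t * (t - h) / 2 :> R.
  by rewrite gauss -nh; field.
(* The total weight is t (t - h) / 2, which would vanish for a single step; two steps already give
   t^2 / 4. *)
have ht : 2 * h <= t by rewrite -nh ler_wpM2r ?(ltW h0)// (ler_nat R 2 n).
set G := h ^+ 2 * _ in hG.
have G1 : t ^+ 2 / 4 <= G by rewrite hG; nra.
have G2 : G <= t ^+ 2 by rewrite hG; nra.
have k1 : Y ^+ 2 * G <= 3 * M ^+ 2 * (D ^+ 2 * G + W + W).
  apply: (@le_trans _ _ (3 * M ^+ 2 * (D ^+ 2 * G +
    h ^+ 2 * (\sum_(j < n) j%:R * P j ^+ 2) + h ^+ 2 * (\sum_(j < n) j%:R * S j ^+ 2)))).
    by move: key2; rewrite /G; lra.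
  rewrite ler_wpM2l ?mulr_ge0 ?sqr_ge0//; lra.
have k2 := ler_wpM2l (sqr_ge0 Y) G1.
have k3 := ler_wpM2l (sqr_ge0 D) G2.
have k4 : 3 * M ^+ 2 * (D ^+ 2 * G + W + W) <= 3 * M ^+ 2 * (D ^+ 2 * t ^+ 2 + W + W).
  by rewrite ler_wpM2l ?mulr_ge0 ?sqr_ge0// !lerD2r.
lra.
Qed.

Lemma weighted_sum_scale (R : realFieldType) n (h k W : R) (P : nat -> R) :
  0 < k -> h ^+ 2 * \sum_(j < n) j%:R * P j ^+ 2 <= W / k ^+ 2 ->
  h ^+ 2 * \sum_(j < n) j%:R * (k * P j) ^+ 2 <= W.
Proof.
move=> k0; rewrite ler_pdivlMr ?exprn_gt0// -mulrA mulr_suml.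
by under [X in _ -> _ * X <= _]eq_bigr do rewrite exprMn mulrCA mulrC.
Qed.

(** [1 + q] replaces the square root of [q]. *)
Lemma sqr_le_lin (R : realFieldType) (y q x : R) :
  0 <= y -> 0 <= x -> 0 <= q -> y ^+ 2 <= q * x ^+ 2 -> y <= (1 + q) * x.
Proof.
move=> y0 x0 q0 h; have q1 : 0 <= 1 + q by lra.
rewrite -(@ler_pXn2r _ 2)// ?nnegrE ?mulr_ge0//; apply: (le_trans h).
rewrite exprMn ler_wpM2r ?sqr_ge0//; nra.
Qed.

(** * A quadratic that maps the right half plane off the negative reals *)

Section Quadratic.
Context (R : realType) (k l : R) (z : cplx R).
Hypotheses (k0 : 0 <= k) (l0 : 0 < l) (z0 : 0 <= Re z).

Lemma quad_neq0 : z != 0 -> toC k * z ^+ 2 + toC l * z != 0.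
Proof.
move=> zn; have -> : toC k * z ^+ 2 + toC l * z = z * (toC k * z + toC l) by ring.
rewrite mulf_neq0//; apply/eqP => /(congr1 (@complex.Re R)).
rewrite ReD Re_toCM -[Re (toC l)]/l -[RHS]/(0 : R) => /eqP.
by rewrite gt_eqF// ltr_wpDl// mulr_ge0.
Qed.

(** For z = x + i y the imaginary part is y (2 k x + l), so a real value forces y = 0 and is then k
    x^2 + l x >= 0. *)
Lemma quad_not_lt0 : ~ (toC k * z ^+ 2 + toC l * z < 0).
Proof.
case: z z0 => x y /= x0; rewrite ltcE /= => /andP[/eqP].
rewrite !mul0r !subr0 !addr0 => h1.
have c0 : 0 <= k * x by rewrite mulr_ge0.
have : y * (2 * (k * x) + l) = 0 by rewrite [RHS]h1; ring.
move/eqP; rewrite mulf_eq0 => /orP[/eqP ->|]; last by rewrite gt_eqF// ltr_wpDl// mulr_ge0.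
rewrite mulr0 subr0 ltNge => /negP; apply.
by rewrite addr_ge0 ?mulr_ge0// ltW.
Qed.

End Quadratic.

(** * Solvability from the lower bound of the spectrum *)

Section Solve.
Context (R : realType) (H : hilbertType R) (A : positive_operator H)
  (mu : R) (mu_min : is_min_spectrum A mu) (mu_gt0 : 0 < mu).

Lemma resolvent_nonpos (l : cplx R) : ~ (0 < l) -> resolvent_set A l.
Proof.
move=> l0; apply: contrapT => hl; apply: l0.
have [_ /(_ l hl)] := mu_min; apply: lt_le_trans.
by rewrite -[0]/(toC 0) ltr_toC.
Qed.

(** After multiplication by - 1 / z this is the resolvent equation at - 1 / z, which is not positive
    because z is not a negative real. *)
Lemma solve_shift (z : cplx R) (f : H) : z != 0 -> ~ (z < 0) ->
  exists u : submod (dom A), \val u + z *: A u = f.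
Proof.
move=> z0 zn; have [|S [SK _ _]] := @resolvent_nonpos (- z^-1).
  by rewrite oppr_gt0 invr_lt0.
exists (S (- z^-1 *: f)); have := congr1 (fun y => - z *: y) (SK (- z^-1 *: f)).
rewrite scalerBr !scalerA mulrNN mulfV// !scale1r !scaleNr !opprK.
by [].
Qed.

Lemma solve_surj (f : H) : exists u : submod (dom A), A u = f.
Proof.
have [|S [SK _ _]] := @resolvent_nonpos 0; first by rewrite ltxx.
exists (S (- f)); have := congr1 -%R (SK (- f)).
by rewrite scale0r sub0r !opprK.
Qed.

End Solve.

(** * The block operator: equivalent norm and resolvent *)

Section Block.
Context (R : realType) (H : hilbertType R) (A : positive_operator H).
Context (a b c : {posnum R}).
Hypothesis A_dense : densely_defined A.
Hypothesis A_selfadjoint : self_adjoint A.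
Context (mu : R) (mu_min : is_min_spectrum A mu) (mu_gt0 : 0 < mu).

(** This value makes the weight alpha^2 b^2 / 4 equal to 1. *)
Let alpha : {posnum R} := (2 / b%:num)%:pos.
Local Notation X := (H2 alpha b A).
Local Notation G := (graph (block_operator alpha a b c A)).

Let bi : R := b%:num^-1.
Let bi0 : 0 < bi. Proof. by rewrite invr_gt0. Qed.
Let HN := rnm_real_norm H.
Let n0 (x : H) : 0 <= rnm x. Proof. exact: rnorm_ge0. Qed.

(* In the coordinate p = A x1 + x2 / b the unbounded parts cancel: the operator
   becomes - diag (0, b A, a A) plus a bounded operator. *)
Definition pcoord (x : X) : H := A x.1.1 + toC bi *: x.1.2.

Definition bnorm (x : X) : R := rnm (pcoord x) + rnm x.1.2 + rnm x.2.

Lemma pcoordD (k : cplx R) (x y : X) : pcoord (k *: x + y) = k *: pcoord x + pcoord y.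
Proof.
rewrite /pcoord /= (linearP (op_fun A)) !scalerDr !scalerA (mulrC k).
by rewrite addrACA.
Qed.

Lemma pcoordB : {morph pcoord : x y / x - y}.
Proof. by move=> x y; rewrite addrC -scaleN1r pcoordD scaleN1r addrC. Qed.

Lemma bnorm_real_norm : real_norm bnorm.
Proof.
have z0 : pcoord 0 = 0.
  by have := pcoordD (-1) 0 0; rewrite scaler0 addr0 scaleN1r addNr.
split=> [x y|k x|x].
- have := pcoordD 1 x y; rewrite !scale1r /bnorm => -> /=.
  have := rnormD HN (pcoord x) (pcoord y).
  have := rnormD HN x.1.2 y.1.2; have := rnormD HN x.2 y.2; lra.
- have := pcoordD k x 0; rewrite !addr0 z0 addr0 /bnorm => -> /=.
  by rewrite !(rnormZ HN) !mulrDr.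
- case: x => [[x1 x2] x3]; rewrite /bnorm /= => h.
  have p0 := n0 (pcoord (x1, x2, x3)); have h2 := n0 x2; have h3 := n0 x3.
  have e2 : x2 = 0 by apply: (rnorm0_eq0 HN); lra.
  have e3 : x3 = 0 by apply: (rnorm0_eq0 HN); lra.
  have : pcoord (x1, x2, x3) = 0 by apply: (rnorm0_eq0 HN); lra.
  rewrite /pcoord /= e2 scaler0 addr0 e3 => A1.
  suff -> : x1 = 0 by [].
  apply/eqP/negPn/negP => /(pos_opP (p := A)).
  by rewrite A1 linear0l ltxx.
Qed.

Lemma block_graphP (x y : X) : G x y <-> exists x1 x2 x3,
  x = (x1, \val x2, \val x3) /\
  y = (x2, - toC (c%:num ^+ 2) *: A x1 - toC b%:num *: A x2 + \val x3,
       - toC a%:num *: A x3).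
Proof.
split=> [[u <- <-]|[x1 [x2 [x3 [-> ->]]]]].
  exists (\val u).1.1, (Submod (block_dom2 u)), (Submod (block_dom3 u)).
  by split=> //=; case: (\val u) => [[? ?] ?].
have h : ((x1, \val x2, \val x3) : X) \in dom (block_operator alpha a b c A).
  by rewrite inE /= !submodP.
exists (Submod h : submod (dom (block_operator alpha a b c A))) => //=.
rewrite /block_fun /=; congr (_, _ - _ *: _ + _, _ *: _); last 2 first.
- by congr (A _); apply: val_inj.
all: try congr (A _).
all: by apply: val_inj.
Qed.

Lemma H2_norm (x : X) :
  rnm x ^+ 2 = rnm (A x.1.1) ^+ 2 + rnm x.1.2 ^+ 2 + rnm x.2 ^+ 2.
Proof.
have h (V : preHilbertType R) (y : V) : inner y y = toC (rnm y ^+ 2).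
  by rewrite -sqr_norm_inner rnmE expr2 -toCM.
apply: (@complexI R).
rewrite -[LHS]h H2_innerE /H2_inner !h.
rewrite [alpha%:num]/=.
have -> : (2 / b%:num) ^+ 2 * b%:num ^+ 2 / 4 = 1 by field.
by rewrite -toCM mul1r -!toCD.
Qed.

Lemma bnorm_le (x : X) : bnorm x <= (3 + bi) * rnm x.
Proof.
have m (s t : R) : 0 <= s -> 0 <= t -> s ^+ 2 <= t ^+ 2 -> s <= t.
  by move=> s0 t0; rewrite ler_pXn2r ?nnegrE.
have x0 : 0 <= rnm x := rnorm_ge0 (rnm_real_norm X) x.
have e := H2_norm x.
have h1 : rnm (A x.1.1) <= rnm x.
  by apply: m => //; rewrite e -addrA lerDl addr_ge0 ?sqr_ge0.
have h2 : rnm x.1.2 <= rnm x.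
  by apply: m => //; rewrite e addrAC lerDr addr_ge0 ?sqr_ge0.
have h3 : rnm x.2 <= rnm x by apply: m => //; rewrite e lerDr addr_ge0 ?sqr_ge0.
have := rnormD HN (A x.1.1) (toC bi *: x.1.2).
rewrite (rnormZ HN) modc_toC ?(ltW bi0)// -/(pcoord x) /bnorm.
have := ler_wpM2l (ltW bi0) h2; lra.
Qed.

Lemma A_pcoord (x : X) : rnm (A x.1.1) <= rnm (pcoord x) + bi * rnm x.1.2.
Proof.
have -> : A x.1.1 = pcoord x - toC bi *: x.1.2 by rewrite /pcoord addrK.
by rewrite (le_trans (rnormB HN _ _))// (rnormZ HN) modc_toC// ltW.
Qed.

Lemma le_bnorm (x : X) : rnm x <= (1 + bi) * bnorm x.
Proof.
have h := A_pcoord x; have p0 := n0 (pcoord x).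
have h1 := n0 (A x.1.1); have h2 := n0 x.1.2; have h3 := n0 x.2.
have x0 : 0 <= rnm x := rnorm_ge0 (rnm_real_norm X) x.
have : rnm x <= rnm (A x.1.1) + rnm x.1.2 + rnm x.2.
  rewrite -(@ler_pXn2r _ 2)// ?nnegrE ?addr_ge0// H2_norm; nra.
have := mulr_ge0 (ltW bi0) p0; have := mulr_ge0 (ltW bi0) h3.
rewrite /bnorm; lra.
Qed.

(** The coordinates p, x2, x3 converge in [H]; the first component of the limit is then recovered by
    solving A l1 = p - l2 / b, as A is onto. *)
Lemma bnorm_complete : ncomplete bnorm.
Proof.
move=> u uC.
have cC (f : X -> H) : {morph f : x y / x - y} ->
    (forall x, rnm (f x) <= bnorm x) ->
    exists l, ncvg (@rnm R H) (fun n => f (u n)) l.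
  move=> fB fk; apply: hilbert_ncomplete => e e0.
  have := uC _ e0; apply: filterS => n hn m nm.
  by rewrite -fB (le_trans (fk _))//; exact: hn.
have le1 x : [/\ rnm (pcoord x) <= bnorm x, rnm x.1.2 <= bnorm x &
    rnm x.2 <= bnorm x].
  have := n0 (pcoord x); have := n0 x.1.2; have := n0 x.2.
  by rewrite /bnorm; split; lra.
have [p hp] := cC pcoord pcoordB (fun x => let: And3 h _ _ := le1 x in h).
have [l2 h2] := cC (fun x => x.1.2) (fun x y => erefl)
  (fun x => let: And3 _ h _ := le1 x in h).
have [l3 h3] := cC (fun x => x.2) (fun x y => erefl)
  (fun x => let: And3 _ _ h := le1 x in h).
have [l1 hl1] := solve_surj mu_min mu_gt0 (p - toC bi *: l2).
exists (l1, l2, l3) => e e0; have e3 : 0 < e / 3 by lra.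
have pl : pcoord (l1, l2, l3) = p by rewrite /pcoord /= hl1 subrK.
near=> n; rewrite /bnorm pcoordB pl /=.
have q1 : rnm (pcoord (u n) - p) <= e / 3 by near: n; exact: hp.
have q2 : rnm ((u n).1.2 - l2) <= e / 3 by near: n; exact: h2.
have q3 : rnm ((u n).2 - l3) <= e / 3 by near: n; exact: h3.
lra.
Unshelve. all: by end_near. Qed.

(** [cpl] bounds [coupling], which enters x2 with factor 1 and p with factor 1 / b; [beta] thus
    bounds the whole perturbation. *)
Let cpl : R := (1 + c%:num ^+ 2) * (1 + bi).
Let beta : R := cpl * (1 + bi).

Let cpl_ge1 : 1 <= cpl.
Proof.
have c0 : 0 <= c%:num ^+ 2 by rewrite exprn_ge0.
have := mulr_ge0 c0 (ltW bi0); rewrite /cpl; have := bi0; lra.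
Qed.

Let beta_gt0 : 0 < beta.
Proof. by rewrite mulr_gt0 ?(lt_le_trans ltr01 cpl_ge1)// addr_gt0. Qed.

(* Up to constant factors, the p and x2 components of the bounded part of the
   operator. *)
Definition coupling (x : X) : H := - toC (c%:num ^+ 2) *: A x.1.1 + x.2.

Lemma coupling_le (x : X) : rnm (coupling x) <= cpl * bnorm x.
Proof.
have c0 : 0 <= c%:num ^+ 2 by rewrite exprn_ge0.
have h := A_pcoord x; have p0 := n0 (pcoord x).
have h1 := n0 (A x.1.1); have h2 := n0 x.1.2; have h3 := n0 x.2.
apply: le_trans (rnormD HN _ _) _.
rewrite (rnormZ HN) modcN modc_toC//.
have H1 := ler_wpM2l c0 h; have B0 := bi0.
have := mulr_ge0 c0 p0; have := mulr_ge0 c0 h2; have := mulr_ge0 c0 h3.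
have := mulr_ge0 (ltW B0) p0; have := mulr_ge0 (ltW B0) h2.
have := mulr_ge0 (ltW B0) h3.
have := mulr_ge0 (mulr_ge0 c0 (ltW B0)) p0.
have := mulr_ge0 (mulr_ge0 c0 (ltW B0)) h2.
have := mulr_ge0 (mulr_ge0 c0 (ltW B0)) h3.
rewrite /cpl /bnorm; lra.
Qed.

(** The A x2 of the first component cancels against 1 / b times the - b A x2 of the second; this
    dictates the coefficient in [pcoord]. *)
Lemma pcoord_block x1 x2 x3 (u := (x1, \val x2, \val x3) : X)
    (v := (x2, - toC (c%:num ^+ 2) *: A x1 - toC b%:num *: A x2 + \val x3,
       - toC a%:num *: A x3) : X) :
  pcoord v = toC bi *: coupling u.
Proof.
rewrite /pcoord /coupling /=.
rewrite -addrA addrCA scalerDr addrA scalerN scalerA -toCM.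
have -> : bi * b%:num = 1 by rewrite mulVf.
by rewrite -[toC 1]/(1 : cplx R) scale1r subrr add0r.
Qed.

(** Accretivity disposes of the diagonal terms b A and a A. The perturbation, of size at most |z|
    [beta] <= 1/2, is absorbed on the left, and 1 + s <= exp s gives the exponential form. *)
Lemma block_resolvent_le (u v : X) (z : cplx R) :
  G u v -> 0 <= Re z -> modc z <= (2 * beta)^-1 ->
  bnorm u <= expR (2 * beta * modc z) * bnorm (u - z *: v).
Proof.
move=> /block_graphP[x1 [x2 [x3 [eu ev]]]] z0 zr.
have m0 := modc_ge0 z; have B0 := bi0.
have scal (k : R) : 0 <= k -> 0 <= Re (toC k * z).
  by move=> k0; rewrite Re_toCM mulr_ge0.
have e3 : rnm u.2 <= rnm (u - z *: v).2.
  rewrite eu ev /= scalerA mulrN scaleNr opprK (mulrC z).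
  exact: (accretive _ (scal _ _)).
have e2 : rnm u.1.2 <= rnm (u - z *: v).1.2 + modc z * rnm (coupling u).
  rewrite eu ev /coupling /= addrAC; set q := _ + \val x3.
  rewrite scalerBr opprB addrCA -(rnormZ HN).
  rewrite (le_trans (accretive _ (scal b%:num _)))//.
  have -> : \val x2 + (toC b%:num * z) *: A x2 =
      (z *: (toC b%:num *: A x2) + (\val x2 - z *: q)) + z *: q.
    by rewrite -addrA subrK addrC scalerA mulrC.
  exact: (rnormD HN).
have e1 : rnm (pcoord u) <= rnm (pcoord (u - z *: v)) + modc z * (bi * rnm (coupling u)).
  have pv : pcoord v = toC bi *: coupling u by rewrite eu ev pcoord_block.
  have -> : pcoord u = pcoord (u - z *: v) + z *: pcoord v.
    rewrite -[pcoord (u - _)]addr0; have := pcoordD z v (u - z *: v).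
    by rewrite addrC subrK => ->; rewrite addr0 addrC.
  rewrite (le_trans (rnormD HN _ _))// lerD2l (rnormZ HN) ler_wpM2l//.
  by rewrite pv (rnormZ HN) modc_toC// ltW.
have k := ler_wpM2l m0 (ler_wpM2l (ltW B0) (coupling_le u)).
have k' := ler_wpM2l m0 (coupling_le u).
have Nu := rnorm_ge0 bnorm_real_norm u.
have s : bnorm u <= bnorm (u - z *: v) + modc z * beta * bnorm u.
  have -> : modc z * beta * bnorm u =
      modc z * (bi * (cpl * bnorm u)) + modc z * (cpl * bnorm u).
    by rewrite /beta; ring.
  have -> : bnorm (u - z *: v) = rnm (pcoord (u - z *: v)) +
    rnm (u - z *: v).1.2 + rnm (u - z *: v).2 by [].
  rewrite {1}/bnorm; apply: (le_trans (lerD (lerD e1 e2) e3)).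
  rewrite -!addrA.
  move: k k'.
  set t1 := modc z * (bi * _); set t2 := modc z * rnm (coupling u).
  set s1 := modc z * (bi * (cpl * _)); set s2 := modc z * (cpl * _).
  set f1 := rnm (pcoord _); set f2 := rnm _; set f3 := rnm _ => k k'.
  move: t1 t2 s1 s2 f1 f2 f3 k k' => t1 t2 s1 s2 f1 f2 f3 k k'.
  lra.
have zb : modc z * beta <= 2^-1.
  by rewrite -ler_pdivlMr// -invfM.
have zb0 : 0 <= modc z * beta by rewrite mulr_ge0// ltW.
have ex := expR_ge1Dx (2 * beta * modc z).
have Nf := rnorm_ge0 bnorm_real_norm (u - z *: v).
apply: (@le_trans _ _ ((1 + 2 * beta * modc z) * bnorm (u - z *: v))).
  have -> : 2 * beta * modc z = 2 * (modc z * beta) by ring.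
  exact: absorb_le.
by rewrite ler_wpM2r.
Qed.

(** Back substitution: the third equation gives u3, and u1 = f1 + z u2 turns the second into an
    equation for u2 with operator 1 + (c^2 z^2 + b z) A, solvable by the facts on the quadratic. *)
Lemma block_solve (z : cplx R) (x : X) : 0 <= Re z -> z != 0 ->
  exists u v : X, G u v /\ u - z *: v = x.
Proof.
move=> z0 zn; case: x => [[f1 f2] f3].
have c20 : 0 <= c%:num ^+ 2 by rewrite exprn_ge0.
have b0 : 0 < b%:num by [].
have az0 : 0 <= Re (toC a%:num * z) by rewrite Re_toCM mulr_ge0.
have azn : toC a%:num * z != 0.
  by rewrite mulf_neq0// toC_neq0.
have [u3 e3] := solve_shift mu_min mu_gt0 f3 azn (Re_ge0_not_lt0 az0).
have [u2 e2] := solve_shift mu_min mu_gt0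
  (f2 + z *: \val u3 - (toC (c%:num ^+ 2) * z) *: A f1) (quad_neq0 c20 b0 z0 zn) (quad_not_lt0 c20 b0 z0).
pose u1 := f1 + z *: u2.
pose v : X := (u2, - toC (c%:num ^+ 2) *: A u1 - toC b%:num *: A u2 + \val u3,
  - toC a%:num *: A u3).
exists (u1, \val u2, \val u3), v; split.
  by apply/block_graphP; exists u1, u2, u3.
rewrite /v; congr (_, _, _) => /=.
- by rewrite /u1 addrK.
- have -> : f2 = \val u2 + (toC (c%:num ^+ 2) * z ^+ 2 + toC b%:num * z) *: A u2 - z *: \val u3 +
      (toC (c%:num ^+ 2) * z) *: A f1 by rewrite e2 addrAC subrK addrK.
  have -> : A u1 = A f1 + z *: A u2 by rewrite /u1 addrC (linearP (op_fun A)) addrC.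
  rewrite !scalerDr !scalerN !scalerA scalerDl.
  rewrite !opprD !mulrN !mulNr !scaleNr !opprK.
  have -> : z * toC (c%:num ^+ 2) * z = toC (c%:num ^+ 2) * z ^+ 2 by ring.
  rewrite !(mulrC z) -!addrA; congr (_ + _).
  by rewrite addrC -!addrA.
- by rewrite -e3 scalerA mulrN scaleNr opprK (mulrC z).
Qed.

(** At z = 0 the equation would force x into the domain, so the identity is prescribed there.
    Elsewhere on the closed half plane [block_solve] provides a solution. *)
Definition block_res (z : cplx R) (x : X) : X :=
  if z == 0 then x else xget x [set u | exists v, G u v /\ u - z *: v = x].

Lemma block_resP z x : 0 <= Re z -> z != 0 ->
  exists2 v, G (block_res z x) v & block_res z x - z *: v = x.
Proof.
move=> z0 zn; rewrite /block_res (negbTE zn).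
have [u hu] := block_solve x z0 zn.
have [v [uv e]] : [set u | exists v, G u v /\ u - z *: v = x]
  (xget x [set u | exists v, G u v /\ u - z *: v = x]) by exact: (xgetI x hu).
by exists v.
Qed.

Lemma graph_linear (K : pzRingType) (V W : lmodType K) (T : operator V W)
    (k : K) (x x' : V) (y y' : W) : graph T x y -> graph T x' y' ->
  graph T (k *: x + x') (k *: y + y').
Proof.
move=> [u <- <-] [u' <- <-]; exists (k *: u + u'); last exact: (linearP (op_fun T)).
by first [exact: (linearP (\val : submod (dom T) -> V))|by []].
Qed.

Lemma graph_fun (K : pzRingType) (V W : lmodType K) (T : operator V W)
    (x : V) (y y' : W) : graph T x y -> graph T x y' -> y = y'.
Proof. by move=> [u <- <-] [u' /val_inj -> <-]. Qed.

Lemma dense_approx (x : H) e : 0 < e ->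
  exists u : submod (dom A), rnm (x - \val u) <= e.
Proof.
move=> e0; have e1 : 0 < toC e :> cplx R by rewrite -[0]/(toC 0) ltr_toC.
have [||y [/= hy yA]] := A_dense (O := ball x (toC e)).
- by exists x; exact: ballxx.
- exact: ball_open.
exists (Submod yA); move: hy; rewrite -ball_normE /= rnmE ltr_toC => /ltW.
by [].
Qed.

Lemma block_half_plane_resolvent :
  half_plane_resolvent bnorm G block_res (2 * beta)^-1 (2 * beta).
Proof.
have b20 : 0 < 2 * beta by rewrite mulr_gt0.
split.
- exact: bnorm_real_norm.
- exact: bnorm_complete.
- by rewrite invr_gt0.
- exact: ltW.
- by move=> *; exact: graph_linear.
- by move=> x y y' h h'; exact: graph_fun h h'.
- move=> [[x1 x2] x3] e e0.
  (* The error in x2 counts [bi + 1] times, in p and in itself, and the error in x3 once. *)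
  have d0 : 0 < e / (bi + 2) by rewrite divr_gt0// addr_gt0.
  have [u2 h2] := dense_approx x2 d0; have [u3 h3] := dense_approx x3 d0.
  eexists (x1, \val u2, \val u3), _; split.
    by apply/block_graphP; exists x1, u2, u3; split; [|reflexivity].
  rewrite /bnorm /pcoord /= subrr (linear0 (op_fun A)) add0r (rnormZ HN).
  rewrite modc_toC ?(ltW bi0)//.
  move: h2 h3; rewrite !ler_pdivlMr ?addr_gt0// => h2 h3.
  have p : 0 < bi + 2 by rewrite addr_gt0.
  rewrite -(ler_pM2r p); have := n0 (x2 - \val u2); have := n0 (x3 - \val u3).
  have := bi0; nra.
- by move=> x; rewrite /block_res eqxx.
- move=> z u v [z0 zr] uv.
  have [->|zn] := eqVneq z 0; first by rewrite scale0r subr0 /block_res eqxx.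
  have [w Gw e] := block_resP (u - z *: v) z0 zn.
  apply/eqP; rewrite -subr_eq0; apply/eqP/(rnorm0_eq0 bnorm_real_norm)/le_anti.
  rewrite (rnorm_ge0 bnorm_real_norm) andbT.
  (* Uniqueness: the difference of two solutions solves the homogeneous equation, where the
     resolvent bound gives zero. *)
  have Gd : G (block_res z (u - z *: v) - u) (w - v).
    by have := graph_linear (-1) uv Gw; rewrite !scaleN1r ![- _ + _]addrC.
  apply: le_trans (block_resolvent_le Gd z0 zr) _.
  have -> : block_res z (u - z *: v) - u - z *: (w - v) = 0.
    by rewrite scalerBr opprB [z *: v - _]addrC addrACA e addrACA subrr addNr addr0.
  by rewrite (rnorm0 bnorm_real_norm) mulr0.
- by move=> z x [z0 zr] zn; exact: block_resP.
- move=> z x [z0 zr]; have [->|zn] := eqVneq z 0.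
    by rewrite /block_res eqxx modc0 mulr0 expR0 mul1r.
  by have [v uv {2}<-] := block_resP x z0 zn; exact: block_resolvent_le.
Qed.

(** * Smoothing by the block operator *)

Let HJ := block_half_plane_resolvent.

Lemma bnorm_image_le x1 x2 x3 (u := (x1, \val x2, \val x3) : X)
    (v := (x2, - toC (c%:num ^+ 2) *: A x1 - toC b%:num *: A x2 + \val x3,
       - toC a%:num *: A x3) : X) :
  bnorm v <= (1 + bi) * rnm (coupling u) + b%:num * rnm (A x2) + a%:num * rnm (A x3).
Proof.
rewrite /bnorm (pcoord_block x1 x2 x3) (rnormZ HN) modc_toC ?(ltW bi0)//.
rewrite [v.2]/(- toC a%:num *: A x3) (rnormZ HN) modcN modc_toC// lerD2r.
rewrite mulrDl mul1r [rnm _ + bi * _]addrC -addrA lerD2l.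
have -> : v.1.2 = coupling u - toC b%:num *: A x2 by rewrite /v /coupling /= addrAC.
by rewrite (le_trans (rnormB HN _ _))// (rnormZ HN) modc_toC.
Qed.

(** With y_j = L w_j, stability gives |y_n| <= M |y_j| for every j <= n, and |y_j| is controlled by
    |A x2| and |A x3| at step j. These have weighted square sums bounded by [euler_energy], with
    forcing [coupling] for x2 and 0 for x3; averaging over j concludes. *)
Lemma block_smoothing : smoothing bnorm G block_res.
Proof.
move=> t t0; set g := 2 * beta; set M := expR (g * t).
have M0 : 0 < M by exact: expR_gt0.
(* The outcome of [weighted_average_le] for D = (1 + bi) F, W = (1 + t + t^2) F^2 and F = cpl M |u|,
   divided by t^2 |u|^2. *)
pose Q := 12 * M ^+ 2 * ((1 + bi) ^+ 2 * t ^+ 2 + 2 * (1 + t + t ^+ 2)) *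
  (cpl * M) ^+ 2 / t ^+ 2.
exists (1 + Q).
have tR : 0 <= Re (toC t) by rewrite /= ltW.
near=> k; move=> u v uv.
have hk : half_disc (2 * beta)^-1 (dyadic k (toC t)).
  by near: k; apply: (near_dyadic_half HJ).
have k1 : (1 <= k)%N by near: k; exact: nbhs_infty_ge.
set n := (2 ^ k)%N; set z := dyadic k (toC t) in hk *.
have n2 : (2 <= n)%N by rewrite /n -[X in (X <= _)%N](expn1 2) leq_exp2l.
have nR : 0 < n%:R :> R by rewrite ltr0n (leq_trans _ n2).
pose h := t / n%:R.
have h0 : 0 < h by rewrite divr_gt0.
have zh : z = toC h.
  by rewrite /z /dyadic /h /n toCM /toC fmorphV rmorph_nat.
have nh : n%:R * h = t by rewrite /h mulrC divfK// gt_eqF.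
pose w j := iter j (block_res z) u; pose y j := iter j (block_res z) v.
have Gwy j : G (w j) (y j).
  by elim: j => //= j IH; exact: (J_graph HJ hk IH).
have step j : w j = w j.+1 - z *: y j.+1.
  rewrite -[z *: y _](J_sub HJ hk (Gwy j)) subKr//.
have rho1 : 1 <= expR (g * modc z).
  by rewrite -expR0 ler_expR mulr_ge0 ?modc_ge0// mulr_ge0// ltW.
have rhon : expR (g * modc z) ^+ n = M.
  by rewrite -expRM_natl zh modc_toC ?(ltW h0)// mulrCA nh.
have iter_le j x : (j <= n)%N -> bnorm (iter j (block_res z) x) <= M * bnorm x.
  move=> jn; have N0 := rnorm_ge0 bnorm_real_norm x.
  apply: (@le_trans _ _ (expR (g * modc z) ^+ j * bnorm x)).
    elim: j {jn} => [|j IH] /=; first by rewrite expr0 mul1r.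
    rewrite exprS -mulrA (le_trans (hpr_bound HJ _ hk))//.
    by rewrite ler_wpM2l ?expR_ge0.
  by rewrite ler_wpM2r// -rhon ler_weXn2l.
have wM j : (j <= n)%N -> bnorm (w j) <= M * bnorm u by exact: iter_le.
have yM j : (j <= n)%N -> bnorm (y n) <= M * bnorm (y j).
  move=> jn; rewrite /y -(subnK jn) iterD; apply: iter_le.
  exact: leq_subr.
have /choice[p hp] j : exists p : submod (dom A) * submod (dom A) * submod (dom A),
    w j = (p.1.1, \val p.1.2, \val p.2) /\
    y j = (p.1.2, - toC (c%:num ^+ 2) *: A p.1.1 - toC b%:num *: A p.1.2 + \val p.2,
       - toC a%:num *: A p.2).
  by have /block_graphP[x1 [x2 [x3 [e1 e2]]]] := Gwy j; exists (x1, x2, x3).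
pose F := cpl * (M * bnorm u).
have Nu := rnorm_ge0 bnorm_real_norm u.
have cpl0 : 0 <= cpl by exact: (le_trans ler01 cpl_ge1).
have F0 : 0 <= F := mulr_ge0 cpl0 (mulr_ge0 (ltW M0) Nu).
(* As [cpl >= 1], the single constant [F] bounds both the forcing terms and the iterates. *)
have MF : M * bnorm u <= F by rewrite ler_peMl ?mulr_ge0 ?(ltW M0)//.
have cF j : (j <= n)%N -> rnm (coupling (w j)) <= F.
  by move=> jn; rewrite (le_trans (coupling_le _))// ler_wpM2l// wM.
have x2F j : (j <= n)%N -> rnm (\val (p j).1.2) <= F.
  move=> jn; apply: le_trans (le_trans (wM j jn) MF).
  by rewrite (hp j).1 /bnorm /= -addrA addrCA lerDl addr_ge0.
have x3F j : (j <= n)%N -> rnm (\val (p j).2) <= F.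
  move=> jn; apply: le_trans (le_trans (wM j jn) MF).
  by rewrite (hp j).1 /bnorm /= lerDr addr_ge0.
have st2 j : \val (p j).1.2 = \val (p j.+1).1.2 -
    toC h *: (coupling (w j.+1) - toC b%:num *: A (p j.+1).1.2).
  have := congr1 (fun x : X => x.1.2) (step j).
  rewrite zh /coupling (hp j).1 (hp j.+1).1 (hp j.+1).2 /= => ->.
  by rewrite [in RHS]addrAC.
have st3 j : \val (p j).2 = \val (p j.+1).2 -
    toC h *: (0 - toC a%:num *: A (p j.+1).2).
  have := congr1 (fun x : X => x.2) (step j).
  rewrite zh (hp j).1 (hp j.+1).1 (hp j.+1).2 /= => ->.
  by rewrite sub0r scaleNr.
have bp : 0 < b%:num by [].
have ap : 0 < a%:num by [].
have E2 := @euler_energy _ _ _ A_selfadjoint (fun j => (p j).1.2)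
  (fun j => coupling (w j)) h b%:num F n h0 bp F0 (fun j _ => st2 j) cF x2F.
have z0F j : (j <= n)%N -> rnm (0 : H) <= F by rewrite (rnorm0 HN).
have E3 := @euler_energy _ _ _ A_selfadjoint (fun j => (p j).2)
  (fun j => 0) h a%:num F n h0 ap F0 (fun j _ => st3 j) z0F x3F.
rewrite nh /= in E2 E3.
have yb j : (j < n)%N -> bnorm (y n) <= M * ((1 + bi) * F +
    b%:num * rnm (A (p j.+1).1.2) + a%:num * rnm (A (p j.+1).2)).
  move=> jn; apply: le_trans (yM j.+1 jn) _; rewrite ler_wpM2l ?(ltW M0)//.
  rewrite (hp j.+1).2; apply: le_trans (bnorm_image_le _ _ _) _.
  rewrite lerD2r lerD2r ler_wpM2l ?addr_ge0 ?(ltW bi0)//.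
  by have := cF j.+1 jn; rewrite (hp j.+1).1.
(* Shifted by one because the implicit scheme attaches the weight j to the value at step j + 1. *)
pose P2 j := rnm (A (p j.+1).1.2); pose P3 j := rnm (A (p j.+1).2).
have W2 := weighted_sum_scale (P := P2) bp E2.
have W3 := weighted_sum_scale (P := P3) ap E3.
have Yt := weighted_average_le (P := fun j => b%:num * P2 j)
  (S := fun j => a%:num * P3 j) n2 h0 nh (rnorm_ge0 bnorm_real_norm (y n)) (ltW M0)
  yb W2 W3.
have -> : euler block_res k (toC t) v = y n by [].
have s0 : 0 <= 1 + t + t ^+ 2 by rewrite !addr_ge0 ?sqr_ge0 ?(ltW t0).
have Q0 : 0 <= Q.
  apply: divr_ge0; last exact: sqr_ge0.
  apply: mulr_ge0; last exact: sqr_ge0.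
  apply: mulr_ge0; first by rewrite mulr_ge0 ?sqr_ge0.
  by apply: addr_ge0; rewrite mulr_ge0 ?sqr_ge0.
apply: (sqr_le_lin (rnorm_ge0 bnorm_real_norm _) Nu Q0).
have t2 : 0 < t ^+ 2 by rewrite exprn_gt0.
rewrite -(ler_pM2r t2); apply: (le_trans Yt); rewrite le_eqVlt; apply/orP; left.
by apply/eqP; rewrite /Q /F; field; rewrite gt_eqF.
Unshelve. all: by end_near. Qed.

End Block.

Theorem theorem3p9 (R : realType) (H : hilbertType R)
    (H_separable : separable H)
    (A : positive_operator H)
    (A_dense : densely_defined A)
    (A_selfadjoint : self_adjoint A)
    (A_closed : closed_operator A)
    (mu : R) (mu_min : is_min_spectrum A mu) (mu_gt0 : 0 < mu)
    (A_power_bounds : power_bounds A)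
    (a b c : {posnum R}) :
  exists alpha : {posnum R},
    generates_analytic_semigroup (block_operator alpha a b c A).
Proof.
exists (2 / b%:num)%:pos.
apply: (half_plane_generates (block_half_plane_resolvent a b c A_dense mu_min mu_gt0)
  (block_smoothing a b c A_dense A_selfadjoint mu_min mu_gt0) _ _
  (@bnorm_le _ _ _ b) (@le_bnorm _ _ _ b)).
- by rewrite addr_gt0// invr_gt0.
- by rewrite addr_gt0// invr_gt0.
Qed.
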